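(* Consider the composite finite-sum problem and the single-loop variance-reduced acceleration algorithm (the ''Algorithm'') described in the context, with the parameter choices listed there: $\{\alpha_t\}_{t\in\mathbb{N}}$ defined from a parameter $\alpha\in[0,1]$, $\tau_t=1/\alpha_t$ for $t\in\mathbb{N}^+$, any fixed mini-batch size $b\in[n]$, $\xi=1/(bc)$, $\tilde{\alpha}_0\ge \xi\alpha_1^2$, and step size $\eta\le 1/(cL+L)$. Then, for any fixed $\alpha\in[0,1]$ in the definition of $\{\alpha_t\}_{t\in\mathbb{N}}$: (i) the convergence rate of the Algorithm (for the expected functional gap $\mathbb{E}[F(w_T)-F(x^* )]$) is $\mathcal{O}(1/T^{\alpha+1})$; (ii) the per-iteration number of IFO calls in expectation is $\mathcal{O}\left(b+\frac{n}{b\,t^{1-\alpha}}+\frac{n}{t}\right)$ for all $t\ge 17$; (iii) assume without loss of generality that the target accuracy satisfies $\epsilon\in(0,1)$, and define $\hat{\alpha}=\max\left\{\frac{\log 2}{\log(\lceil 1/\epsilon\rceil)},\frac{\log 2}{\log n}\right\}$. Then the number of IFO calls in expectation needed by the Algorithm to reach an $\epsilon$-accurate solution is $$\mathbb{E}C_{\mathrm{comp}}=\begin{cases}\mathcal{O}\left(\dfrac{b}{\epsilon^{1/(\alpha+1)}}+n\min\{\log n,\log(1/\epsilon)\}\right), & \alpha\in\left(0,\min\{\hat{\alpha},1/10\}\right],\\[2mm] \mathcal{O}\left(\dfrac{b}{\epsilon^{1/(\alpha+1)}}+\left(\dfrac{n}{b}\,\dfrac{1}{\epsilon^{\alpha/(\alpha+1)}}+n\right)\min\{\log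 n,\log(1/\epsilon)\}\right), & \alpha\in\left(\min\{\hat{\alpha},1/10\},1\right].\end{cases}$$ Here $T\in\mathbb{N}^+$ is the total iteration number, $t\in[T]$ is the iteration counter, $n\in\mathbb{N}^+$ is the number of smooth component functions, and $b\in[n]$ is the mini-batch size.
   Context: Problem. $\min_{x\in\mathbb{R}^d}F(x):=f(x)+l(x)$ with $f(x)=\frac1n\sum_{i=1}^n f_i(x)$. Standing assumptions: (A1) the problem has at least one solution, and $x^*$ denotes one fixed solution; (A2) the functions $f_i:\mathbb{R}^d\to\mathbb{R}$ are $L$-smooth for some $L>0$: $f_i(y)\le f_i(x)+\langle\nabla f_i(x),y-x\rangle+\frac L2\|y-x\|^2$ for all $x,y\in\mathbb{R}^d$; (A3) the functions $f_i$ are convex: $f_i(y)\ge f_i(x)+\langle\nabla f_i(x),y-x\rangle$ for all $x,y\in\mathbb{R}^d$; (A4) $l$ is convex and lower semicontinuous (but possibly non-differentiable) and admits an efficient proximal operator. $\|\cdot\|$ is the Euclidean norm, $[n]=\{1,\dots,n\}$, $\mathbb{N}$ is the set of non-negative integers, $\mathbb{N}^+$ the set of positive integers. Algorithm. Initial point $w_1=x_1=y_1=z_1$. For $t=1,2,\dots$: - $x_{t+1}=\tau_t z_t+\xi w_t+(1-\xi-\tau_t)y_t$; - pick $J_t\subset[n]$ according to the uniform distribution on the set of all subsets of $[n]$ of cardinality $b$; - $\tilde g_{t+1}=\frac1b\sum_{j\in J_t}\left(\nabla f_j(x_{t+1})-\nabla f_j(w_t)\right)+\nabla f(w_t)$;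 - $z_{t+1}=\arg\min_{z\in\mathbb{R}^d}\left\{\frac{1}{2\alpha_t\eta}\|z-z_t\|^2+\langle\tilde g_{t+1},z\rangle+l(z)\right\}$; - $y_{t+1}=x_{t+1}+\tau_t(z_{t+1}-z_t)$; - $w_{t+1}=y_t$ with probability $p_t$ and $w_{t+1}=w_t$ with probability $1-p_t$, where $$p_t=\frac{\alpha_{t-1}^2-\alpha_t^2+\alpha_t+\xi\alpha_t^2}{\tilde\alpha_0+\alpha_0^2-\alpha_t^2+\sum_{j=1}^t\alpha_j}.$$ Parameters. For $\alpha\in[0,1]$: $\alpha_t=6$ for $0\le t\le 16$ and $\alpha_t=a_\alpha t^\alpha$ for $t\ge17$, where $a_\alpha=6$ if $\alpha=0$; $a_\alpha=1+\frac{\sqrt2}{4}$ if $\alpha\in(0,1/2]$; $a_\alpha=\frac13$ if $\alpha\in(1/2,3/4]$; $a_\alpha=\frac14\left(\frac{17}{16}\right)^{\alpha-1}$ if $\alpha\in(3/4,1]$. Further $c=\max\{2,\,b^{-1}\max\{6/5,(1-\alpha_{17}^{-1})^{-1}\}\}+1$. Cost model. In the incremental first-order oracle (IFO) framework, sampling an index $i$ and computing the pair $(f_i(x),\nabla f_i(x))$ costs one unit (one IFO call). A full gradient is computed at the checkpoint $w_{t+1}$ when the checkpoint is replaced, so the Algorithm makes $\mathcal{O}(b+np_t)$ IFO calls in expectation in iteration $t$. A point $x$ is an $\epsilon$-accurate solution iff $\mathbb{E}[F(x)-F(x^* )]\le\epsilon$. The IFO complexity $C_{\mathrm{comp}}$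 is the minimum number of IFO calls needed to reach an $\epsilon$-accurate solution; the sequence considered is the checkpoint sequence $\{w_t\}$.
   Formalization: In (iii) the hidden constant is uniform for ε in (0, ε0] and may depend on an arbitrary fixed ε0 < 1; with one constant for all ε in (0,1) the bound fails (ε = 1 − 1/n, b = 1, n → ∞). *)

(* Defs.v *)
(* MathComp + MathComp-Analysis *)
From HB Require Import structures.
From mathcomp Require Import all_boot all_order all_algebra.
From mathcomp Require Import all_classical all_reals all_analysis.

Set Implicit Arguments.
Unset Strict Implicit.
Unset Printing Implicit Defensive.

Import Order.TTheory GRing.Theory Num.Theory.
Import numFieldNormedType.Exports.

Local Open Scope classical_set_scope.
Local Open Scope ring_scope.

(* The library norm on 'rV[R]_d is the sup norm: it is only used for the
   topology.  Lengths and inner products below are the Euclidean ones. *)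
Definition dotp {R : realType} {d : nat} (u v : 'rV[R]_d) : R :=
  \sum_(j < d) u 0 j * v 0 j.

Definition sqnorm {R : realType} {d : nat} (u : 'rV[R]_d) : R := dotp u u.

Definition grad {R : realType} {d : nat} (h : 'rV[R]_d -> R) (x : 'rV[R]_d) :
    'rV[R]_d :=
  \row_(j < d) 'D_(delta_mx 0 j) h x.

Definition is_argmin {R : realType} {T : Type} (h : T -> \bar R) (z : T) : Prop :=
  forall u : T, (h z <= h u)%E.

(* As l > -oo, no indeterminate form arises; recall that 0 * +oo = 0. *)
Definition econvex {R : realType} {d : nat} (l : 'rV[R]_d -> \bar R) : Prop :=
  forall (x y : 'rV[R]_d) (s : R), 0 <= s <= 1 ->
    (l (s *: x + (1 - s) *: y)%R <= s%:E * l x + (1 - s)%:E * l y)%E.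

Record problem (R : realType) := Problem {
  pb_dim : nat;
  pb_n : nat;
  pb_f : 'I_pb_n -> 'rV[R]_pb_dim -> R;
  pb_l : 'rV[R]_pb_dim -> \bar R;
  pb_sol : 'rV[R]_pb_dim }.

Definition favg {R : realType} (pb : problem R) (x : 'rV[R]_(pb_dim pb)) : R :=
  (pb_n pb)%:R^-1 * \sum_(i < pb_n pb) pb_f i x.
Arguments favg {R} pb x.

(* F = f + l; the regularizer l takes values in R with +oo added (so that
   indicators of closed convex sets are allowed), hence so does F. *)
Definition objective {R : realType} (pb : problem R) (x : 'rV[R]_(pb_dim pb)) :
    \bar R :=
  ((favg pb x)%:E + pb_l x)%E.
Arguments objective {R} pb x.

Record assumptions {R : realType} (pb : problem R) (L : R) : Prop := Assumptions {
  asm_sol : is_argmin (objective pb) (pb_sol pb);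
  asm_L : 0 < L;
  asm_diff : forall (i : 'I_(pb_n pb)) (x : 'rV[R]_(pb_dim pb)),
    differentiable (pb_f i) x;
  asm_smooth : forall (i : 'I_(pb_n pb)) (x y : 'rV[R]_(pb_dim pb)),
    pb_f i y <= pb_f i x + dotp (grad (pb_f i) x) (y - x)
                + L / 2 * sqnorm (y - x);
  asm_convex : forall (i : 'I_(pb_n pb)) (x y : 'rV[R]_(pb_dim pb)),
    pb_f i x + dotp (grad (pb_f i) x) (y - x) <= pb_f i y;
  asm_reg_gtNy : forall x : 'rV[R]_(pb_dim pb), (-oo < pb_l x)%E;
  asm_reg_proper : exists x : 'rV[R]_(pb_dim pb), (pb_l x < +oo)%E;
  asm_reg_convex : econvex (@pb_l R pb);
  asm_reg_lsc : lower_semicontinuous (@pb_l R pb) }.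

Definition coef_a {R : realType} (alpha : R) : R :=
  if alpha == 0 then 6
  else if alpha <= 1 / 2 then 1 + Num.sqrt 2 / 4
  else if alpha <= 3 / 4 then 1 / 3
  else 1 / 4 * (17 / 16) `^ (alpha - 1).

Definition alpha_seq {R : realType} (alpha : R) (t : nat) : R :=
  if (t <= 16)%N then 6 else coef_a alpha * t%:R `^ alpha.

Definition tau_seq {R : realType} (alpha : R) (t : nat) : R :=
  (alpha_seq alpha t)^-1.

Definition const_c {R : realType} (alpha : R) (b : nat) : R :=
  Num.max 2 (b%:R^-1 * Num.max (6 / 5) (1 - (alpha_seq alpha 17)^-1)^-1) + 1.

Definition xi {R : realType} (alpha : R) (b : nat) : R :=
  (b%:R * const_c alpha b)^-1.

Definition update_prob {R : realType} (alpha atilde0 : R) (b t : nat) : R :=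
  let a := alpha_seq alpha in
  (a t.-1 ^+ 2 - a t ^+ 2 + a t + xi alpha b * a t ^+ 2)
  / (atilde0 + a 0%N ^+ 2 - a t ^+ 2 + \sum_(1 <= j < t.+1) a j).

Record parameters (R : realType) := MkParameters {
  par_alpha : R;
  par_b : nat;
  par_atilde0 : R;
  par_eta : R }.

Record admissible {R : realType} (pb : problem R) (L : R) (th : parameters R) :
    Prop := Admissible {
  adm_alpha : 0 <= par_alpha th <= 1;
  adm_b : (1 <= par_b th <= pb_n pb)%N;
  adm_atilde0 :
    xi (par_alpha th) (par_b th) * alpha_seq (par_alpha th) 1 ^+ 2
      <= par_atilde0 th;
  adm_eta_gt0 : 0 < par_eta th;
  adm_eta : par_eta th <= 1 / (const_c (par_alpha th) (par_b th) * L + L) }.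

(* Random variables of one execution, indexed by t >= 1 (the values at 0 are
   irrelevant): the iterates, the gradient estimator, the mini-batch J_t and the
   coin deciding whether the checkpoint is replaced in iteration t. *)
Record process {R : realType} (pb : problem R) (Omega : Type) := Process {
  px : nat -> Omega -> 'rV[R]_(pb_dim pb);
  py : nat -> Omega -> 'rV[R]_(pb_dim pb);
  pz : nat -> Omega -> 'rV[R]_(pb_dim pb);
  pw : nat -> Omega -> 'rV[R]_(pb_dim pb);
  pg : nat -> Omega -> 'rV[R]_(pb_dim pb);
  pJ : nat -> Omega -> {set 'I_(pb_n pb)};
  pcoin : nat -> Omega -> bool }.

(* smp_indep: mutual independence of the whole family J_1, coin_1, J_2, coin_2,
   and so on; taking some A t or B t to be setT yields every finite subfamily. *)
Record sampling {R : realType} {pb : problem R} (th : parameters R)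
    {dsp : measure_display} {Omega : measurableType dsp}
    (P : probability Omega R) (pr : process pb Omega) : Prop := Sampling {
  smp_measJ : forall (t : nat) (S : {set 'I_(pb_n pb)}), (0 < t)%N ->
    measurable (pJ pr t @^-1` [set S]);
  smp_meascoin : forall (t : nat) (c : bool), (0 < t)%N ->
    measurable (pcoin pr t @^-1` [set c]);
  smp_lawJ : forall (t : nat) (S : {set 'I_(pb_n pb)}), (0 < t)%N ->
    P (pJ pr t @^-1` [set S]) =
      (if #|S| == par_b th then 'C(pb_n pb, par_b th)%:R^-1 else 0)%:E;
  smp_lawcoin : forall t : nat, (0 < t)%N ->
    P (pcoin pr t @^-1` [set true]) =
      (update_prob (par_alpha th) (par_atilde0 th) (par_b th) t)%:E;
  smp_indep : forall (s : seq nat) (A : nat -> set {set 'I_(pb_n pb)})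
      (B : nat -> set bool), uniq s -> all (leq 1) s ->
    P (\bigcap_(t in [set` s]) (pJ pr t @^-1` A t `&` pcoin pr t @^-1` B t)) =
      (\prod_(t <- s) (P (pJ pr t @^-1` A t) * P (pcoin pr t @^-1` B t)))%E }.

Record recursion {R : realType} {pb : problem R} (th : parameters R)
    (w1 : 'rV[R]_(pb_dim pb)) {Omega : Type} (pr : process pb Omega) : Prop :=
    Recursion {
  rec_init : forall o : Omega,
    [/\ pw pr 1 o = w1, px pr 1 o = w1, py pr 1 o = w1 & pz pr 1 o = w1];
  rec_x : forall (t : nat) (o : Omega), (0 < t)%N ->
    let tau := tau_seq (par_alpha th) t in
    let x0 := xi (par_alpha th) (par_b th) in
    px pr t.+1 o =
      tau *: pz pr t o + x0 *: pw pr t o + (1 - x0 - tau) *: py pr t o;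
  rec_g : forall (t : nat) (o : Omega), (0 < t)%N ->
    pg pr t.+1 o =
      (par_b th)%:R^-1 *: \sum_(j in pJ pr t o)
        (grad (pb_f j) (px pr t.+1 o) - grad (pb_f j) (pw pr t o))
      + grad (favg pb) (pw pr t o);
  rec_z : forall (t : nat) (o : Omega), (0 < t)%N ->
    is_argmin
      (fun z : 'rV[R]_(pb_dim pb) =>
        ((1 / (2 * alpha_seq (par_alpha th) t * par_eta th)
            * sqnorm (z - pz pr t o)
          + dotp (pg pr t.+1 o) z)%:E + pb_l z)%E)
      (pz pr t.+1 o);
  rec_y : forall (t : nat) (o : Omega), (0 < t)%N ->
    py pr t.+1 o =
      px pr t.+1 o
      + tau_seq (par_alpha th) t *: (pz pr t.+1 o - pz pr t o);
  rec_w : forall (t : nat) (o : Omega), (0 < t)%N ->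
    pw pr t.+1 o = if pcoin pr t o then py pr t o else pw pr t o }.

(* A raw integral since the objective is extended real-valued. *)
Definition expected_gap {R : realType} {pb : problem R}
    {dsp : measure_display} {Omega : measurableType dsp}
    (P : probability Omega R) (pr : process pb Omega) (t : nat) : \bar R :=
  (\int[P]_o (objective pb (pw pr t o) - objective pb (pb_sol pb)))%E.

(* Iteration t evaluates grad f_j at x_{t+1} and at w_t for the b indices j of
   the mini-batch, and all n gradients if the checkpoint is replaced. *)
Definition ifo_calls {R : realType} {pb : problem R} (th : parameters R)
    {Omega : Type} (pr : process pb Omega) (t : nat) (o : Omega) : R :=
  (2 * par_b th + pb_n pb * pcoin pr t o)%:R.

(* w_T is produced by iterations 1, ..., T-1; the leading n is the full
   gradient at the initial checkpoint w_1. *)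
Definition ifo_total {R : realType} {pb : problem R} (th : parameters R)
    {Omega : Type} (pr : process pb Omega) (T : nat) (o : Omega) : R :=
  (pb_n pb)%:R + \sum_(1 <= t < T) ifo_calls th pr t o.

(* +oo if no checkpoint is eps-accurate. *)
Definition expected_complexity {R : realType} {pb : problem R}
    (th : parameters R)
    {dsp : measure_display} {Omega : measurableType dsp}
    (P : probability Omega R) (pr : process pb Omega) (eps : R) : \bar R :=
  ereal_inf [set ('E_P[ifo_total th pr T])%E |
    T in [set T : nat | (0 < T)%N /\ (expected_gap P pr T <= eps%:E)%E]].

(* For n = 1 the second quotient is 0 instead of the conventional +oo; this is
   immaterial, as the factor min (ln n) (ln (1 / eps)) then vanishes and both
   branches of complexity_bound coincide. *)
Definition alpha_hat {R : realType} (n : nat) (eps : R) : R :=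
  Num.max (ln 2 / ln (Num.ceil (1 / eps))%:~R) (ln 2 / ln n%:R).

Definition complexity_bound {R : realType} (alpha : R) (n b : nat) (eps : R) : R :=
  let lg := Num.min (ln n%:R) (ln (1 / eps)) in
  if alpha <= Num.min (alpha_hat n eps) (1 / 10) then
    b%:R / eps `^ (1 / (alpha + 1)) + n%:R * lg
  else
    b%:R / eps `^ (1 / (alpha + 1))
    + (n%:R / b%:R * (1 / eps `^ (alpha / (alpha + 1))) + n%:R) * lg.

(* Main.v *)
(* Let [gap u] be [F u - F x*] and let [A_t] be the denominator of
   the update probability [p_t].  Smoothness, Young's inequality with the weight
   [xi = 1 / (b c)], which absorbs the variance of the estimator (sampling
   without replacement and co-coercivity of the gradients), and the three-point
   inequality of the proximal step show that
     alpha_t^2 gap y_(t+1) + A_t gap w_(t+1) + |z_(t+1) - x*|^2 / (2 eta)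
   has non-increasing expectation: the numerator of [p_t] is exactly what makes
   the coefficients telescope.  As [A_t >= t^(1 + alpha) / 40] uniformly in
   [alpha], this gives (i), while bounding numerator and denominator of [p_t]
   gives (ii).  Claim (iii) follows by summing (ii) up to a horizon of order
   [eps^(-1 / (alpha + 1))].  Expectations are finite sums: the
   iterates at time [t] depend only on the finitely many possible histories of
   the first draws, because the proximal minimizer is unique. *)

(* The recursion is a hypothesis on outcomes: a proximal minimizer is read off an outcome, never
   constructed. The average over mini-batches in one step therefore needs every set of size [b] to
   be drawn at some outcome extending the given history; this follows from the product form of the
   probabilities.

   In the one-step estimate, co-coercivity bounds the variance by the Bregman distance
   [f w - f x - <grad f x, w - x>]. This is exactly the slack of the convexity inequality at the
   checkpoint, so giving [w] the weight [xi] pays for the variance.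

   The constant of (iii) has to serve all [alpha] in (0, 1] at once, so the parameter estimates are
   uniform in [alpha]. The remaining danger is the factor [1 / alpha] from summing
   [t ^ (alpha - 1)]: above [alpha_hat] it is at most logarithmic, below [alpha_hat] the sum is
   compared with a harmonic one. Keeping [eps <= eps0 < 1] bounds the logarithmic factor away from 0
   for [n >= 2], so that it can absorb constants and the initial full gradient. *)
Require Import Defs.
From HB Require Import structures.
From mathcomp Require Import all_boot all_order all_algebra.
From mathcomp Require Import all_fingroup.
From mathcomp Require Import all_classical all_reals all_analysis.
From mathcomp Require Import ring lra.

Set Implicit Arguments.
Unset Strict Implicit.
Unset Printing Implicit Defensive.

Import Order.TTheory GRing.Theory Num.Theory.
Import numFieldNormedType.Exports.

Local Open Scope classical_set_scope.
Local Open Scope ring_scope.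

(** * Euclidean products and sampling without replacement *)

Section Dotp.
Context {R : realType} {d : nat}.
Implicit Types (u v w : 'rV[R]_d) (a : R).

Lemma dotpC u v : dotp u v = dotp v u.
Proof. by apply: eq_bigr => j _; rewrite mulrC. Qed.

Lemma dotpDl u v w : dotp (u + v) w = dotp u w + dotp v w.
Proof. by rewrite /dotp -big_split; apply: eq_bigr => j _; rewrite !mxE mulrDl. Qed.

Lemma dotpZl a u v : dotp (a *: u) v = a * dotp u v.
Proof. by rewrite /dotp mulr_sumr; apply: eq_bigr => j _; rewrite !mxE mulrA. Qed.

Lemma dotpNl u v : dotp (- u) v = - dotp u v.
Proof. by rewrite -scaleN1r dotpZl mulN1r. Qed.

Lemma dotpDr u v w : dotp u (v + w) = dotp u v + dotp u w.
Proof. by rewrite dotpC dotpDl !(dotpC u). Qed.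

Lemma dotpZr a u v : dotp u (a *: v) = a * dotp u v.
Proof. by rewrite dotpC dotpZl (dotpC u). Qed.

Lemma dotpNr u v : dotp u (- v) = - dotp u v.
Proof. by rewrite dotpC dotpNl dotpC. Qed.

Lemma dotp_suml (I : Type) (r : seq I) (Q : pred I) (F : I -> 'rV[R]_d) v :
  dotp (\sum_(i <- r | Q i) F i) v = \sum_(i <- r | Q i) dotp (F i) v.
Proof.
elim/big_rec2: _ => [|i x y _ <-]; last by rewrite dotpDl.
by rewrite /dotp big1// => j _; rewrite mxE mul0r.
Qed.

Lemma sqnorm_ge0 u : 0 <= sqnorm u.
Proof. by apply: sumr_ge0 => j _; rewrite -expr2 sqr_ge0. Qed.

Lemma sqnorm_eq0 u : sqnorm u = 0 -> u = 0.
Proof.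
move=> /eqP; rewrite psumr_eq0 => [/allP h|j _]; last by rewrite -expr2 sqr_ge0.
apply/rowP => j; rewrite mxE; apply/eqP.
by have := h j (mem_index_enum j); rewrite -expr2 sqrf_eq0.
Qed.

End Dotp.

Definition dotpE {R : realType} {d : nat} :=
  (@dotpDl R d, @dotpDr R d, @dotpZl R d, @dotpZr R d, @dotpNl R d, @dotpNr R d).

Section SubsetAverage.
Context {R : realType} {n : nat}.
Variable b : nat.
Hypothesis hb : (1 <= b <= n)%N.

Definition subset_avg (h : {set 'I_n} -> R) : R :=
  'C(n, b)%:R^-1 * \sum_(J : {set 'I_n} | #|J| == b) h J.

Lemma subset_avgD h1 h2 :
  subset_avg (fun J => h1 J + h2 J) = subset_avg h1 + subset_avg h2.
Proof. by rewrite /subset_avg big_split mulrDr. Qed.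

Lemma subset_avgZ a h : subset_avg (fun J => a * h J) = a * subset_avg h.
Proof. by rewrite /subset_avg -mulr_sumr mulrCA. Qed.

Lemma subset_avg_sum (I : Type) (r : seq I) (Q : pred I)
    (F : I -> {set 'I_n} -> R) :
  subset_avg (fun J => \sum_(i <- r | Q i) F i J) =
  \sum_(i <- r | Q i) subset_avg (F i).
Proof. by rewrite /subset_avg exchange_big mulr_sumr. Qed.

Lemma subset_avg_cst a : subset_avg (fun=> a) = a.
Proof.
rewrite /subset_avg (eq_bigl (fun J => J \in [set J : {set 'I_n} | #|J| == b]%SET)).
  rewrite sumr_const card_draws card_ord -(mulr_natl a) mulKf// pnatr_eq0 -lt0n bin_gt0.
  by case/andP: hb.
by move=> J; rewrite inE.
Qed.

Lemma le_subset_avg h1 h2 : (forall J : {set 'I_n}, #|J| = b -> h1 J <= h2 J) ->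
  subset_avg h1 <= subset_avg h2.
Proof.
move=> h; rewrite /subset_avg ler_wpM2l ?invr_ge0//.
by apply: ler_sum => J /eqP; exact: h.
Qed.

Lemma eq_subset_avg h1 h2 : (forall J : {set 'I_n}, #|J| = b -> h1 J = h2 J) ->
  subset_avg h1 = subset_avg h2.
Proof. by move=> h; congr (_ * _); apply: eq_bigr => J /eqP; exact: h. Qed.

(** Relabelling the indices permutes the sets of size [b]. This symmetry makes the inclusion
    probabilities of one index, and of two distinct indices, independent of the indices. *)
Lemma subset_avg_perm (s : {perm 'I_n}) h :
  subset_avg (fun J => h (s @: J)) = subset_avg h.
Proof.
congr (_ * _); rewrite [RHS](reindex_inj (imset_inj (@perm_inj _ s))).
by apply: eq_bigl => J; rewrite card_imset//; exact: perm_inj.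
Qed.

Lemma subset_avg_mem i : subset_avg (fun J => (i \in J)%:R) = b%:R / n%:R.
Proof.
have n0 : n%:R != 0 :> R.
  by rewrite pnatr_eq0; case/andP: hb => b1 bn; rewrite -lt0n (leq_trans b1).
have eqi j : subset_avg (fun J => (j \in J)%:R) =
    subset_avg (fun J => (i \in J)%:R).
  rewrite -(subset_avg_perm (tperm i j)); apply: eq_subset_avg => J _.
  by rewrite -{1}(tpermL i j) mem_imset//; exact: perm_inj.
have : \sum_j subset_avg (fun J => (j \in J)%:R) = b%:R.
  rewrite -subset_avg_sum -[RHS]subset_avg_cst; apply: eq_subset_avg => J Jb.
  rewrite -natr_sum -[in RHS]Jb -sum1_card [in RHS]big_mkcond; congr _%:R.
rewrite (eq_bigr _ (fun j _ => eqi j)) sumr_const card_ord.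
rewrite -[X in X = _ -> _]mulr_natr => <-.
by rewrite mulfK.
Qed.

(** The common value stays abstract: the variance bound drops the term in [m], for which its sign
    suffices. The value 0 covers a population without two distinct indices. *)
Lemma subset_avg_mem2 : exists2 m : R, 0 <= m &
  forall i j, i != j -> subset_avg (fun J => ((i \in J) && (j \in J))%:R) = m.
Proof.
have [[[i0 j0] /= ij0]|no] :=
    pselect (exists ij : 'I_n * 'I_n, ij.1 != ij.2); last first.
  by exists 0 => // i j ij; exfalso; apply: no; exists (i, j).
exists (subset_avg (fun J => ((i0 \in J) && (j0 \in J))%:R)) => [|i j ij].
  by rewrite mulr_ge0 ?invr_ge0 ?sumr_ge0.
(* Send [i] to [i0], then the image of [j] to [j0]; the second transposition fixes [i0], which
   differs from both of its points. *)
pose s : {perm 'I_n} := (tperm i i0 * tperm (tperm i i0 j) j0)%g.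
have si : s i = i0.
  rewrite permM tpermL; apply: tpermD; last by rewrite eq_sym.
  by rewrite -[X in _ != X](tpermL i i0) (inj_eq perm_inj) eq_sym.
have sj : s j = j0 by rewrite permM tpermL.
rewrite -[RHS](subset_avg_perm s); apply: eq_subset_avg => J _.
by rewrite -si -sj !mem_imset//; exact: perm_inj.
Qed.

Lemma subset_avg_sample (a : 'I_n -> R) :
  subset_avg (fun J => \sum_(j in J) a j) = b%:R / n%:R * \sum_j a j.
Proof.
transitivity (subset_avg (fun J => \sum_j a j * (j \in J)%:R)).
  apply: eq_subset_avg => J _; rewrite big_mkcond.
  by apply: eq_bigr => j _; case: (j \in J); rewrite ?mulr1 ?mulr0.
rewrite subset_avg_sum mulr_sumr; apply: eq_bigr => j _.
by rewrite subset_avgZ subset_avg_mem mulrC.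
Qed.

(* Sampling without replacement: distinct indices are negatively correlated
   because the centred population sums to zero. *)
Lemma subset_avg_variance (a : 'I_n -> R) :
  subset_avg (fun J => (b%:R^-1 * (\sum_(j in J) a j) - n%:R^-1 * \sum_j a j) ^+ 2)
  <= (b%:R * n%:R)^-1 * \sum_j a j ^+ 2.
Proof.
have b0 : b%:R != 0 :> R by rewrite pnatr_eq0 -lt0n; case/andP: hb.
have n0 : n%:R != 0 :> R.
  by rewrite pnatr_eq0; case/andP: hb => b1 bn; rewrite -lt0n (leq_trans b1).
pose mu := n%:R^-1 * \sum_j a j; pose u j := a j - mu.
have sumu : \sum_j u j = 0.
  by rewrite sumrB sumr_const card_ord -(mulr_natl mu) /mu mulVKf// subrr.
have [m m0 mE] := subset_avg_mem2.
have main : subset_avg (fun J => (\sum_(j in J) u j) ^+ 2) =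
    (b%:R / n%:R - m) * \sum_j u j ^+ 2.
  transitivity (subset_avg
      (fun J => \sum_i \sum_j u i * u j * ((i \in J) && (j \in J))%:R)).
    apply: eq_subset_avg => J _.
    rewrite expr2 big_distrl [LHS]big_mkcond; apply: eq_bigr => i _ /=.
    case: (i \in J) => /=; last by rewrite big1// => j _; rewrite mulr0.
    rewrite big_distrr /= big_mkcond; apply: eq_bigr => j _.
    by case: (j \in J); rewrite ?mulr1 ?mulr0.
  rewrite subset_avg_sum mulr_sumr; apply: eq_bigr => i _.
  rewrite subset_avg_sum (bigD1 i)//=.
  under eq_bigr => j ji do rewrite subset_avgZ mE 1?eq_sym//.
  rewrite subset_avgZ.
  have -> : subset_avg (fun J => ((i \in J) && (i \in J))%:R) = b%:R / n%:R.
    by rewrite -(subset_avg_mem i); apply: eq_subset_avg => J _; rewrite andbb.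
  rewrite -mulr_suml -mulr_sumr.
  have -> : \sum_(j | j != i) u j = - u i.
    by move: sumu; rewrite (bigD1 i)//= addrC => /eqP; rewrite addr_eq0 => /eqP.
  by ring.
(* Centring can only decrease the sum of squares. *)
have sq : \sum_j u j ^+ 2 <= \sum_j a j ^+ 2.
  have -> : \sum_j a j ^+ 2 = \sum_j u j ^+ 2 + n%:R * mu ^+ 2.
    transitivity (\sum_j (u j ^+ 2 + (2 * mu * u j + mu ^+ 2))).
      by apply: eq_bigr => j _; rewrite /u; ring.
    rewrite big_split big_split /= -mulr_sumr sumu mulr0 add0r.
    by rewrite sumr_const card_ord (mulr_natl (mu ^+ 2)).
  by rewrite lerDl mulr_ge0// sqr_ge0.
rewrite (_ : subset_avg _ =
    b%:R^-1 ^+ 2 * subset_avg (fun J => (\sum_(j in J) u j) ^+ 2)).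
  rewrite main.
  apply: (@le_trans _ _ (b%:R^-1 ^+ 2 * (b%:R / n%:R) * \sum_j u j ^+ 2)).
    rewrite -mulrA ler_wpM2l ?sqr_ge0// ler_wpM2r//.
      by apply: sumr_ge0 => j _; exact: sqr_ge0.
    by rewrite gerBl.
  rewrite (_ : _ * (b%:R / n%:R) = (b%:R * n%:R)^-1); last by field; apply/andP.
  by rewrite ler_wpM2l// invr_ge0 mulr_ge0.
rewrite -subset_avgZ; apply: eq_subset_avg => J Jb.
rewrite -exprMn sumrB sumr_const Jb -/mu -(mulr_natl mu); congr (_ ^+ 2).
by rewrite mulrBr mulKf.
Qed.

Lemma subset_avg_variance_vec {d : nat} (v : 'I_n -> 'rV[R]_d) :
  subset_avg (fun J =>
    sqnorm (b%:R^-1 *: (\sum_(j in J) v j) - n%:R^-1 *: \sum_j v j))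
  <= (b%:R * n%:R)^-1 * \sum_j sqnorm (v j).
Proof.
rewrite /sqnorm /dotp subset_avg_sum exchange_big mulr_sumr.
apply: ler_sum => k _.
under [X in _ <= _ * X]eq_bigr do rewrite -expr2.
apply: le_trans (subset_avg_variance (fun j => v j 0 k)).
by apply: le_subset_avg => J _; rewrite !mxE !summxE expr2.
Qed.

Lemma subset_avg_dotp {d : nat} (v : 'I_n -> 'rV[R]_d) (u : 'rV[R]_d) :
  subset_avg (fun J => dotp (b%:R^-1 *: \sum_(j in J) v j) u) =
  dotp (n%:R^-1 *: \sum_j v j) u.
Proof.
have b0 : b%:R != 0 :> R by rewrite pnatr_eq0 -lt0n; case/andP: hb.
under eq_subset_avg do rewrite dotpZl dotp_suml.
by rewrite subset_avgZ subset_avg_sample dotpZl dotp_suml mulrA mulrA mulVf// mul1r.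
Qed.

End SubsetAverage.

(** * Smooth convex functions and the proximal step *)

Section SmoothConvex.
Context {R : realType} {d : nat}.
Variables (f : 'rV[R]_d -> R) (G : 'rV[R]_d -> 'rV[R]_d) (L : R).
Hypotheses (L0 : 0 < L)
  (smoothf : forall x y, f y <= f x + dotp (G x) (y - x) + L / 2 * sqnorm (y - x))
  (convexf : forall x y, f x + dotp (G x) (y - x) <= f y).

(* Compare both bounds at the gradient step [w - (G w - G x) / L]. *)
Lemma smooth_cocoercive x w :
  sqnorm (G x - G w) <= 2 * L * (f w - f x - dotp (G x) (w - x)).
Proof.
have [g eg] : exists g, g = G w - G x by eexists.
pose v := w - L^-1 *: g.
have := convexf x v; have := smoothf w v.
have -> : v - w = - (L^-1 *: g) by rewrite /v addrAC subrr add0r.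
have -> : v - x = (w - x) - L^-1 *: g by rewrite /v addrAC.
have -> : sqnorm (G x - G w) = sqnorm g.
  by rewrite -[G x - G w]opprB -eg /sqnorm dotpNl dotpNr opprK.
rewrite /sqnorm !dotpE => h1 h2.
have e : dotp (G w) g = dotp (G x) g + dotp g g.
  by rewrite -dotpDl eg subrKC.
have {}h : dotp g g / (2 * L) <= f w - f x - (dotp (G x) w - dotp (G x) x).
  have : L / 2 * - (L^-1 * - (L^-1 * dotp g g)) = dotp g g / (2 * L).
    by field; rewrite gt_eqF.
  have : L^-1 * dotp g g = 2 * (dotp g g / (2 * L)) by field; rewrite gt_eqF.
  rewrite e in h1; lra.
by rewrite ler_pdivrMr ?mulr_gt0// in h; rewrite mulrC.
Qed.

End SmoothConvex.

Section Regularizer.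
Context {R : realType} {d : nat}.
Variable l : 'rV[R]_d -> \bar R.
Hypotheses (lNy : forall x, (-oo < l x)%E) (lconv : econvex l).

Lemma econvex_fin (s lx ly : R) x y : 0 <= s <= 1 ->
    l x = lx%:E -> l y = ly%:E ->
  exists2 m : R, l (s *: x + (1 - s) *: y) = m%:E & m <= s * lx + (1 - s) * ly.
Proof.
move=> s01 ex ey; have := lconv x y s01; have := lNy (s *: x + (1 - s) *: y).
rewrite ex ey; case: (l _) => [m _|_|//]; last by rewrite leye_eq.
by rewrite lee_fin => h; exists m.
Qed.

(** Jensen for three points, in the order in which [y_(t+1)] combines [z_(t+1)], [w_t] and [y_t].
    The case [s = 1] is apart because the weights are renormalised by [1 - s]. *)
Lemma econvex_fin3 (s t lx ly lz : R) x y z : 0 <= s -> 0 <= t -> 0 <= 1 - t - s ->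
    l x = lx%:E -> l y = ly%:E -> l z = lz%:E ->
  exists2 m : R, l (s *: x + t *: y + (1 - t - s) *: z) = m%:E &
    m <= s * lx + t * ly + (1 - t - s) * lz.
Proof.
move=> s0 t0 r0 ex ey ez.
have [s1|s1] := eqVneq (1 - s) 0.
  have -> : t = 0 by lra.
  have -> : s = 1 by lra.
  rewrite subr0 subrr !scale0r !addr0 scale1r !mul0r !addr0 mul1r.
  by exists lx.
have s1' : 0 < 1 - s by rewrite lt_neqAle eq_sym s1; lra.
pose q := t / (1 - s).
have q01 : 0 <= q <= 1.
  by rewrite divr_ge0//= ?ler_pdivrMr ?mul1r//; lra.
have [m em hm] := econvex_fin q01 ey ez.
have s01 : 0 <= s <= 1 by lra.
have [k ek hk] := econvex_fin s01 ex em.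
have e1 : (1 - s) * q = t by rewrite /q mulrC divfK.
have e2 : (1 - s) * (1 - q) = 1 - t - s by rewrite mulrBr e1; ring.
clearbody q.
exists k; first by rewrite -ek scalerDr !scalerA e1 e2 addrA.
apply: (le_trans hk); rewrite -addrA lerD2l.
have -> : t * ly + (1 - t - s) * lz = (1 - s) * (q * ly + (1 - q) * lz).
  by rewrite -e2 -e1; ring.
by rewrite ler_wpM2l// ltW.
Qed.

(** Compare the minimizer with [s *: u + (1 - s) *: zp], divide by [s] and let [s] tend to 0. *)
Lemma prox_three_point (k lp lu : R) g z zp u : 0 < k ->
    is_argmin (fun v => ((k * sqnorm (v - z) + dotp g v)%:E + l v)%E) zp ->
    l zp = lp%:E -> l u = lu%:E ->
  lp + dotp g (zp - u) + k * sqnorm (zp - u) + k * sqnorm (zp - z) <=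
    lu + k * sqnorm (z - u).
Proof.
move=> k0 amin ep eu.
have step s : 0 < s <= 1 ->
    lp + dotp g (zp - u) + k * sqnorm (zp - u) + k * sqnorm (zp - z) <=
    lu + k * sqnorm (z - u) + s * (k * sqnorm (u - zp)).
  move=> /andP[s0 s1]; have s01 : 0 <= s <= 1 by rewrite ltW.
  have [m em hm] := econvex_fin s01 eu ep.
  have := amin (s *: u + (1 - s) *: zp); rewrite em ep -!EFinD lee_fin => h.
  rewrite -(ler_pM2l s0).
  have e : s *: u + (1 - s) *: zp = zp + s *: (u - zp).
    by rewrite scalerBr scalerBl scale1r addrCA addrA.
  rewrite e in h; move: h hm.
  rewrite /sqnorm !dotpE.
  rewrite (dotpC u zp) (dotpC z zp) (dotpC z u).
  by lra.
apply/ler_addgt0Pr => e e0.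
pose q := k * sqnorm (u - zp).
have q0 : 0 <= q by rewrite mulr_ge0 ?sqnorm_ge0// ltW.
(* This [s] makes the remainder [s * q] at most [e]; the denominator [q + 1] stays positive when
   [q = 0]. *)
have := @step (Num.min 1 (e / (q + 1))).
have q1 : 0 < q + 1 by lra.
have e1 : 0 < e / (q + 1) by rewrite divr_gt0.
rewrite lt_min ltr01 e1 ge_min lexx => /(_ isT) /le_trans; apply.
rewrite -/q lerD2l (@le_trans _ _ (e / (q + 1) * q))//.
  by rewrite ler_wpM2r// ge_min lexx orbT.
by rewrite mulrAC ler_pdivrMr//; nra.
Qed.

(** A point of finite value bounds the minimum. As [q] is any real function, this also covers the
    solution of the problem itself. *)
Lemma prox_fin (q : 'rV[R]_d -> R) zp : (exists x, (l x < +oo)%E) ->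
    is_argmin (fun v => ((q v)%:E + l v)%E) zp ->
  l zp \is a fin_num.
Proof.
move=> [x lx] /(_ x) h; rewrite fin_numElt lNy /=.
have : ((q zp)%:E + l zp < +oo)%E.
  by apply: (le_lt_trans h); rewrite lte_add_pinfty// ltry.
by case: (l zp) => //= r _; rewrite ltry.
Qed.

(** The three-point inequality at the other minimizer leaves [k * sqnorm (z1 - z2) <= 0]. *)
Lemma prox_unique (k : R) g z z1 z2 : 0 < k -> (exists x, (l x < +oo)%E) ->
    is_argmin (fun v => ((k * sqnorm (v - z) + dotp g v)%:E + l v)%E) z1 ->
    is_argmin (fun v => ((k * sqnorm (v - z) + dotp g v)%:E + l v)%E) z2 ->
  z1 = z2.
Proof.
move=> k0 lx m1 m2.
have /fineK/esym e1 := prox_fin lx m1; have /fineK/esym e2 := prox_fin lx m2.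
have := prox_three_point k0 m1 e1 e2.
have := m2 z1; rewrite e1 e2 -!EFinD lee_fin => h1 h2.
apply/eqP; rewrite -subr_eq0; apply/eqP/sqnorm_eq0/eqP.
rewrite eq_le sqnorm_ge0 andbT -(pmulr_rle0 _ k0).
move: h1 h2; rewrite dotpDr dotpNr.
have -> : sqnorm (z - z2) = sqnorm (z2 - z).
  by rewrite -[z - z2]opprB /sqnorm dotpNl dotpNr opprK.
by lra.
Qed.

End Regularizer.

Section Average.
Context {R : realType}.
Variables (pb : problem R) (L : R).
Hypotheses (asm : assumptions pb L) (n0 : (0 < pb_n pb)%N).
Local Notation n := (pb_n pb).

Lemma grad_favg x : grad (favg pb) x = n%:R^-1 *: \sum_i grad (pb_f i) x.
Proof.
apply/rowP => j; rewrite !mxE summxE.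
have -> : favg pb = n%:R^-1 *: \sum_(i < n) pb_f i.
  by apply/funext => u; rewrite /favg fct_sumE.
have dv i : derivable (pb_f i : _ -> R^o) x (delta_mx 0 j).
  exact/diff_derivable/(asm_diff asm).
rewrite (@deriveZ R _ R^o); last exact: derivable_sum.
rewrite derive_sum//; congr (_ * _); apply: eq_bigr => i _.
by rewrite mxE.
Qed.

Lemma favg_dotp (v : 'I_n -> 'rV[R]_(pb_dim pb)) u :
  dotp (n%:R^-1 *: \sum_i v i) u = n%:R^-1 * \sum_i dotp (v i) u.
Proof. by rewrite dotpZl dotp_suml. Qed.

Lemma favg_smooth x y : favg pb y <=
  favg pb x + dotp (grad (favg pb) x) (y - x) + L / 2 * sqnorm (y - x).
Proof.
have nn : n%:R != 0 :> R by rewrite pnatr_eq0 -lt0n.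
have -> : L / 2 * sqnorm (y - x) =
    n%:R^-1 * \sum_(i < n) L / 2 * sqnorm (y - x).
  by rewrite sumr_const card_ord -(mulr_natl (_ * _)) mulKf.
rewrite grad_favg favg_dotp -!mulrDr -!big_split ler_wpM2l ?invr_ge0//=.
by apply: ler_sum => i _; exact: (asm_smooth asm).
Qed.

Lemma favg_convex x y :
  favg pb x + dotp (grad (favg pb) x) (y - x) <= favg pb y.
Proof.
rewrite grad_favg favg_dotp -!mulrDr -!big_split ler_wpM2l ?invr_ge0//=.
by apply: ler_sum => i _; exact: (asm_convex asm).
Qed.

Definition estimator (b : nat) (x w : 'rV[R]_(pb_dim pb)) (J : {set 'I_n}) :=
  b%:R^-1 *: (\sum_(j in J) (grad (pb_f j) x - grad (pb_f j) w))
  + grad (favg pb) w.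

Lemma estimator_unbiased b x w u : (1 <= b <= n)%N ->
  subset_avg b (fun J => dotp (estimator b x w J) u) = dotp (grad (favg pb) x) u.
Proof.
move=> hb; under eq_subset_avg do rewrite dotpDl.
rewrite subset_avgD subset_avg_dotp// subset_avg_cst// -dotpDl sumrB scalerBr.
by rewrite -!grad_favg subrK.
Qed.

Lemma estimator_variance b x w : (1 <= b <= n)%N ->
  subset_avg b (fun J => sqnorm (grad (favg pb) x - estimator b x w J)) <=
  2 * L / b%:R * (favg pb w - favg pb x - dotp (grad (favg pb) x) (w - x)).
Proof.
move=> hb; have L0 := asm_L asm.
pose v j := grad (pb_f j) x - grad (pb_f j) w.
apply: (@le_trans _ _ ((b%:R * n%:R)^-1 * \sum_j sqnorm (v j))).
  apply: le_trans (subset_avg_variance_vec hb v); apply: le_subset_avg => J _.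
  have -> : grad (favg pb) x - estimator b x w J =
      - (b%:R^-1 *: (\sum_(j in J) v j) - n%:R^-1 *: \sum_j v j).
    rewrite /estimator -/v [X in _ - n%:R^-1 *: X]sumrB scalerBr -!grad_favg.
    by rewrite opprB opprD addrA addrAC.
  by rewrite /sqnorm dotpNl dotpNr opprK.
have -> : 2 * L / b%:R * (favg pb w - favg pb x - dotp (grad (favg pb) x) (w - x)) =
    (b%:R * n%:R)^-1 * \sum_(j < n)
      2 * L * (pb_f j w - pb_f j x - dotp (grad (pb_f j) x) (w - x)).
  rewrite grad_favg favg_dotp /favg -!mulrBr -!sumrB -mulr_sumr invfM.
  by ring.
rewrite ler_wpM2l ?invr_ge0 ?mulr_ge0//; apply: ler_sum => j _.
exact: (smooth_cocoercive L0 (@asm_smooth _ _ _ asm j) (@asm_convex _ _ _ asm j)).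
Qed.

(** A real number, so that expectations become finite real sums. Since [fine] sends +oo to 0, it is
    meaningful only where [pb_l] is finite, as [iterates_fin] ensures along the run. *)
Definition gap (u : 'rV[R]_(pb_dim pb)) : R :=
  favg pb u + fine (pb_l u) - (favg pb (pb_sol pb) + fine (pb_l (pb_sol pb))).

Lemma sol_fin : pb_l (pb_sol pb) \is a fin_num.
Proof. exact: (prox_fin (asm_reg_gtNy asm) (asm_reg_proper asm) (asm_sol asm)). Qed.

Lemma objective_gap u : pb_l u \is a fin_num ->
  (objective pb u - objective pb (pb_sol pb))%E = (gap u)%:E.
Proof.
move=> /fineK fu; have /fineK fs := sol_fin.
by rewrite /objective -fu -fs.
Qed.

Lemma gap_ge0 u : pb_l u \is a fin_num -> 0 <= gap u.
Proof.
move=> fu; rewrite -lee_fin -objective_gap// sube_ge0 ?(asm_sol asm)//.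
by rewrite !fin_numD fu sol_fin.
Qed.

End Average.

(** * One iteration: descent for a given estimator, then on average *)

Section OneStep.
Context {R : realType}.
Variables (pb : problem R) (L : R).
Hypotheses (asm : assumptions pb L) (n0 : (0 < pb_n pb)%N).
Local Notation n := (pb_n pb).
Local Notation l := (@pb_l R pb).
Local Notation xs := (pb_sol pb).
Variables (A tau q eta c : R) (x y z w : 'rV[R]_(pb_dim pb)).
Hypotheses (A0 : 0 < A) (tauE : tau = A^-1) (q0 : 0 <= q) (r0 : 0 <= 1 - q - tau)
  (eta0 : 0 < eta) (c0 : 0 < c) (etaL : (c + 1) * L * eta <= 1)
  (xE : x = tau *: z + q *: w + (1 - q - tau) *: y)
  (lw : l w \is a fin_num) (ly : l y \is a fin_num).

Let prox g zp := is_argmin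
  (fun v => ((1 / (2 * A * eta) * sqnorm (v - z) + dotp g v)%:E + l v)%E) zp.

(** Here [g] is any vector, and its error is charged to the term over [2 * c * L]. The finiteness
    claim carries the finiteness of [l] from one iterate to the next. *)
Lemma sample_descent g zp : prox g zp ->
  l (x + tau *: (zp - z)) \is a fin_num /\
  A ^+ 2 * (favg pb (x + tau *: (zp - z)) + fine (l (x + tau *: (zp - z))))
    + sqnorm (zp - xs) / (2 * eta) <=
  A ^+ 2 * (favg pb x + q * fine (l w) + (1 - q - tau) * fine (l y)
      + tau * fine (l xs) + sqnorm (grad (favg pb) x - g) / (2 * c * L)
      + tau * dotp g (xs - z))
    + sqnorm (z - xs) / (2 * eta).
Proof.
move=> pz; have L0 := asm_L asm; have tau0 : 0 < tau by rewrite tauE invr_gt0.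
have lz := prox_fin (asm_reg_gtNy asm) (asm_reg_proper asm) pz.
have [ezp ew ey es] : [/\ l zp = (fine (l zp))%:E, l w = (fine (l w))%:E,
    l y = (fine (l y))%:E & l xs = (fine (l xs))%:E].
  by split; rewrite fineK// (sol_fin asm).
set yp := x + _; pose d := zp - z.
(* Putting [zp] for [z] in [xE] gives the new [y], so the convexity of [l] applies to it. *)
have ypE : yp = tau *: zp + q *: w + (1 - q - tau) *: y.
  by rewrite /yp xE scalerBr addrC !addrA subrK.
have [m em hm] := econvex_fin3 (asm_reg_gtNy asm) (asm_reg_convex asm)
  (ltW tau0) q0 r0 ezp ew ey.
rewrite -ypE in em; split; rewrite em//=.
have k0 : 0 < 1 / (2 * A * eta) by rewrite divr_gt0// !mulr_gt0.
have three := prox_three_point (asm_reg_gtNy asm) (asm_reg_convex asm) k0 pz ezp es.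
have sm := favg_smooth asm n0 x yp.
have dE : yp - x = tau *: d by rewrite /yp addrAC subrr add0r.
(* The weight [c * L] adds [c * L / 2] to the curvature [L / 2] of smoothness; the step-size
   condition lets the proximal term absorb the sum. *)
have young : dotp (grad (favg pb) x - g) (tau *: d) <=
    sqnorm (grad (favg pb) x - g) / (2 * c * L) + c * L / 2 * sqnorm (tau *: d).
  move: (grad _ x - g) (tau *: d) => u v.
  have := sqnorm_ge0 (u - (c * L) *: v).
  have cL : 0 < 2 * c * L by rewrite !mulr_gt0.
  have -> : sqnorm u / (2 * c * L) + c * L / 2 * sqnorm v =
      (sqnorm u + (c * L) ^+ 2 * sqnorm v) / (2 * c * L).
    by field; rewrite !gt_eqF.
  rewrite ler_pdivlMr// /sqnorm !dotpE (dotpC v u); lra.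
have dz : dotp g (tau *: d) = tau * dotp g (zp - xs) + tau * dotp g (xs - z).
  by rewrite -mulrDr -dotpDr addrA subrK dotpZr.
have sq : sqnorm (tau *: d) = tau ^+ 2 * sqnorm d.
  by rewrite /sqnorm dotpZl dotpZr mulrA.
rewrite dE sq in sm; rewrite sq in young.
have gE : dotp (grad (favg pb) x) (tau *: d) =
    dotp (grad (favg pb) x - g) (tau *: d) + dotp g (tau *: d).
  by rewrite -dotpDl subrK.
have At : A * tau = 1 by rewrite tauE divff// gt_eqF.
have eta' : (c + 1) * L / 2 <= (2 * eta)^-1.
  by rewrite -[X in _ <= X]mul1r ler_pdivlMr ?mulr_gt0//; have := etaL; lra.
have kE : A * (1 / (2 * A * eta)) = (2 * eta)^-1.
  by field; rewrite !gt_eqF.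
move: three sm young hm; rewrite gE dz -/d.
move: (sqnorm_ge0 d) At eta' kE A0.
move: (1 / (2 * A * eta)) (sqnorm d) (sqnorm (zp - xs)) (sqnorm (z - xs)) => k D Dp Dz.
move: (dotp g (zp - xs)) (dotp g (xs - z)) (dotp _ (tau *: d)) => a1 a2 a3.
move: (_ / (2 * c * L)) (fine (l zp)) (fine (l w)) (fine (l y)) (fine (l xs)).
move=> V lzp lw' ly' ls D0 At eta' kE A0' three sm young hm.
have h1 : favg pb yp + m <= favg pb x + q * lw' + (1 - q - tau) * ly' + tau * ls
    + V + tau * a2 + tau * (lzp + a1 - ls) + (c + 1) * L / 2 * (tau ^+ 2 * D).
  lra.
(* Scaled by [A], the proximal coefficient becomes [1 / (2 * eta)], the same in every iteration. *)
have h2 : A * (lzp + a1 - ls) <= (2 * eta)^-1 * (Dz - Dp - D).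
  rewrite -kE -mulrA ler_pM2l//; lra.
have h3 : (c + 1) * L / 2 * D <= (2 * eta)^-1 * D by rewrite ler_wpM2r.
have e1 : A ^+ 2 * (tau * (lzp + a1 - ls)) = A * (lzp + a1 - ls).
  by rewrite expr2 -mulrA [A * (tau * _)]mulrA At mul1r.
have e2 : A ^+ 2 * ((c + 1) * L / 2 * (tau ^+ 2 * D)) = (c + 1) * L / 2 * D.
  by rewrite mulrCA [A ^+ 2 * _]mulrA -exprMn At expr1n mul1r.
have h4 := ler_wpM2l (sqr_ge0 A) h1.
rewrite !(mulrDr (A ^+ 2)) e1 e2 in h4.
rewrite !(mulrDr (A ^+ 2)); lra.
Qed.

(** Convexity is spent at [xs] and at [y], while at [w] its slack is kept: with [q = 1 / (b c)] it
    pays exactly for the bound on the averaged estimator error. *)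
Lemma expected_descent (b : nat) (zJ : {set 'I_n} -> 'rV[R]_(pb_dim pb)) :
    (1 <= b <= n)%N -> q = (b%:R * c)^-1 ->
    (forall J : {set 'I_n}, #|J| = b -> prox (estimator b x w J) (zJ J)) ->
  subset_avg b (fun J => A ^+ 2 * gap (x + tau *: (zJ J - z))
      + sqnorm (zJ J - xs) / (2 * eta)) <=
  q * A ^+ 2 * gap w + (A ^+ 2 - q * A ^+ 2 - A) * gap y
    + sqnorm (z - xs) / (2 * eta).
Proof.
move=> hb qE hJ; have L0 := asm_L asm.
have b0 : 0 < b%:R :> R by rewrite ltr0n; case/andP: hb.
pose G := grad (favg pb) x; pose Fs := favg pb xs + fine (l xs).
pose K := favg pb x + q * fine (l w) + (1 - q - tau) * fine (l y)
      + tau * fine (l xs).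
apply: (@le_trans _ _ (subset_avg b (fun J =>
    A ^+ 2 / (2 * c * L) * sqnorm (G - estimator b x w J)
    + (A ^+ 2 * tau * dotp (estimator b x w J) (xs - z)
    + (A ^+ 2 * (K - Fs) + sqnorm (z - xs) / (2 * eta)))))).
  apply: le_subset_avg => J Jb; have [_] := sample_descent (hJ J Jb).
  rewrite /gap -/K -/G -/Fs => h; move: h.
  rewrite (mulrAC (A ^+ 2) (_^-1)) !mulrDr mulrN; lra.
rewrite !subset_avgD !subset_avgZ !subset_avg_cst// (estimator_unbiased asm)//.
have At : A * tau = 1 by rewrite tauE divff// gt_eqF.
have var : A ^+ 2 / (2 * c * L) *
    subset_avg b (fun J => sqnorm (G - estimator b x w J)) <=
    A ^+ 2 * (q * (favg pb w - favg pb x - dotp G (w - x))).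
  have k0 : 0 <= A ^+ 2 / (2 * c * L) by rewrite divr_ge0 ?sqr_ge0// ltW// !mulr_gt0.
  apply: (le_trans (ler_wpM2l k0 (estimator_variance asm x w hb))).
  by rewrite le_eqVlt; apply/orP; left; apply/eqP; rewrite qE -/G; field;
    rewrite !gt_eqF.
(* By [xE], the differences to [x] taken with these weights add up to [tau *: (xs - z)]. *)
have lin : tau * dotp G (xs - z) = tau * dotp G (xs - x) + q * dotp G (w - x)
    + (1 - q - tau) * dotp G (y - x).
  have -> : dotp G (xs - z) = dotp G xs - dotp G z by rewrite dotpDr dotpNr.
  have : dotp G x = tau * dotp G z + q * dotp G w + (1 - q - tau) * dotp G y.
    by rewrite {1}xE !dotpE.
  rewrite !(dotpDr, dotpNr); nra.
have cs := favg_convex asm x xs; have cy := favg_convex asm x y.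
rewrite -/G in cs cy.
have tau0 : 0 <= tau by rewrite tauE invr_ge0 ltW.
have cs' := ler_wpM2l tau0 cs; have cy' := ler_wpM2l r0 cy.
rewrite -/G -[A ^+ 2 * tau * _]mulrA lin.
have main : q * (favg pb w - favg pb x - dotp G (w - x)) +
    (tau * dotp G (xs - x) + q * dotp G (w - x)
    + (1 - q - tau) * dotp G (y - x)) + (K - Fs) <=
    q * gap w + (1 - q - tau) * gap y.
  rewrite /gap -/Fs /K; rewrite /Fs; lra.
have := ler_wpM2l (sqr_ge0 A) main.
have -> : A ^+ 2 * (q * gap w + (1 - q - tau) * gap y) =
    q * A ^+ 2 * gap w + (A ^+ 2 - q * A ^+ 2 - A) * gap y.
  have -> : A ^+ 2 - q * A ^+ 2 - A = A ^+ 2 * (1 - q - tau).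
    have e : A ^+ 2 * tau = A by rewrite expr2 -mulrA At mulr1.
    by rewrite !mulrBr mulr1 e; ring.
  by ring.
rewrite !(mulrDr (A ^+ 2)); lra.
Qed.

End OneStep.

(** * Parameter sequences *)

Section ParameterSequences.
Context {R : realType}.
Implicit Types (alpha x y : R) (b t : nat).

(** Division-free monotonicity of [u ^ (alpha - 1)]; it reduces to [r ^ alpha <= r] for
    [r = y / x >= 1]. *)
Lemma powR_ratio_le alpha x y : alpha <= 1 -> 0 < x -> x <= y ->
  x * y `^ alpha <= y * x `^ alpha.
Proof.
move=> a1 x0 xy; have yx : 1 <= y / x by rewrite ler_pdivlMr ?mul1r.
have -> : y = (y / x) * x by rewrite divfK// gt_eqF.
rewrite powRM ?(ltW x0)//; last exact: le_trans yx.
by rewrite mulrCA -mulrA ler_wpM2r ?mulr_ge0 ?powR_ge0 ?(ltW x0)// ler1_powR.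
Qed.

(** What the later estimates use of the piecewise coefficient. The fourth bound keeps [tau_t < 1],
    and the last one makes the sum in the denominator of [p_t] dominate [alpha_t ^ 2]. The slope 3/8
    is attained at [alpha = 0], [x = 16]. *)
Lemma coef_a_spec alpha : 0 <= alpha <= 1 -> let a := coef_a alpha in
  [/\ 1 / 5 <= a, a <= 6, a * 16 `^ alpha <= 16, 1 < a * 17 `^ alpha &
      forall x, 16 <= x -> a * x `^ alpha <= 3 / 8 * x].
Proof.
move=> /andP[a0 a1] /=.
have sq16 : 16 `^ (1 / 2) = 4 :> R.
  rewrite (_ : 16 = 4 `^ 2%:R); last by rewrite powR_mulrn//; lra.
  by rewrite -powRrM (_ : 2%:R * (1 / 2) = 1) ?powRr1//; field.
have ge1 x : 1 <= x -> 1 <= x `^ alpha.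
  by move=> x1; rewrite -[leLHS](powRr0 x) ler_powR.
have ltx x : 1 <= x -> x `^ alpha <= x by move=> x1; rewrite ler1_powR.
have le1617 r : 0 <= r -> 16 `^ r <= 17 `^ r :> R.
  by move=> r0; rewrite ge0_ler_powR// ?nnegrE//; lra.
rewrite /coef_a; case: eqVneq => [->|an0].
  by split=> [||||x x16]; rewrite ?powRr0; lra.
have h16 := ltx 16 ltac:(lra).
have h17 := ge1 17 ltac:(lra).
case: ifPn => [ah|]; [|rewrite -ltNge => ah].
  have s2 : 0 < Num.sqrt (2 : R) <= 3 / 2.
    rewrite sqrtr_gt0 ltr0n /= -[leRHS]ger0_norm; last lra.
    by rewrite -sqrtr_sqr ler_sqrt; lra.
  move: (Num.sqrt 2) s2 => s /andP[s0 s2].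
  have p4 : 16 `^ alpha <= 4 by rewrite -sq16 ler_powR//; lra.
  have k0 : 0 <= 16 `^ alpha :> R := powR_ge0 _ _.
  split; [lra|lra|nra|nra|] => x x16.
  have x0 : 0 < x by lra.
  suff : x `^ alpha <= x / 4 by nra.
  have h : x `^ alpha <= x `^ (1 / 2) by rewrite ler_powR//; lra.
  have e : x `^ (1 / 2) * x `^ (1 / 2) = x.
    rewrite -powRD; last by rewrite gt_eqF ?implybT.
    by rewrite (_ : 1 / 2 + 1 / 2 = 1) ?powRr1 ?ltW//; field.
  have h4 : 4 <= x `^ (1 / 2).
    by rewrite -sq16 ge0_ler_powR ?nnegrE//; lra.
  nra.
have sq17 : 4 <= 17 `^ alpha.
  by rewrite -sq16 (le_trans (le1617 (1 / 2) ltac:(lra)))// ler_powR//; lra.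
case: ifPn => [ah'|]; [|rewrite -ltNge => ah'].
  split; [lra|lra|lra|lra|] => x x16.
  have := ltx x ltac:(lra); lra.
have h8 : 8 <= 17 `^ alpha.
  apply: (@le_trans _ _ (17 `^ (3 / 4))); last by rewrite ler_powR//; lra.
  apply: (le_trans _ (le1617 (3 / 4) ltac:(lra))).
  rewrite (_ : 16 = 2 `^ 4%:R); last by rewrite powR_mulrn//; lra.
  rewrite -powRrM (_ : 4%:R * (3 / 4) = 3%:R); last by field.
  by rewrite powR_mulrn//; lra.
have k1 : (17 / 16) `^ (alpha - 1) <= 1 :> R.
  rewrite -[leRHS](powRr0 (17 / 16)) ler_powR//; lra.
have k2 : 16 / 17 <= (17 / 16) `^ (alpha - 1) :> R.
  rewrite (_ : 16 / 17 = (17 / 16) `^ (-1)); last by rewrite powR_inv1; lra.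
  by rewrite ler_powR//; lra.
split; [lra|lra|nra|nra|] => x x16.
have := ltx x ltac:(lra); have := powR_ge0 x alpha; nra.
Qed.

Section Sequence.
Variable alpha : R.
Hypothesis ha : 0 <= alpha <= 1.
Local Notation a := (coef_a alpha).
Local Notation s := (alpha_seq alpha).

Lemma alpha_seq_small t : (t <= 16)%N -> s t = 6.
Proof. by rewrite /alpha_seq => ->. Qed.

Lemma alpha_seq_large t : (17 <= t)%N -> s t = a * t%:R `^ alpha.
Proof. by move=> ht; rewrite /alpha_seq leqNgt ht. Qed.

(** Stated from 17 on because the sequence may drop below 6 when the second formula takes over. *)
Lemma alpha_seq_le t u : (17 <= t)%N -> (t <= u)%N -> s t <= s u.
Proof.
move=> t17 tu; rewrite !alpha_seq_large ?(leq_trans t17)//.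
have [a5 _ _ _ _] := coef_a_spec ha; have /andP[a0 _] := ha.
rewrite ler_wpM2l//; first lra.
by rewrite ge0_ler_powR ?nnegrE// ler_nat.
Qed.

Lemma alpha_seq17_gt1 : 1 < s 17.
Proof. by rewrite alpha_seq_large//; have [] := coef_a_spec ha. Qed.

Lemma alpha_seq_gt1 t : 1 < s t.
Proof.
have [t16|t17] := leqP t 16; first by rewrite alpha_seq_small//; lra.
exact: lt_le_trans alpha_seq17_gt1 (alpha_seq_le (leqnn _) t17).
Qed.

Lemma alpha_seq_gt0 t : 0 < s t.
Proof. exact: lt_trans (alpha_seq_gt1 t). Qed.

Lemma const_c_ge3 b : 3 <= const_c alpha b.
Proof. by rewrite /const_c (_ : 3 = 2 + 1); [rewrite lerD2r le_max lexx|ring]. Qed.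

Lemma xi_gt0 b : (0 < b)%N -> 0 < xi alpha b.
Proof.
move=> b0; rewrite /xi invr_gt0 mulr_gt0 ?ltr0n//.
by have := const_c_ge3 b; lra.
Qed.

Lemma xi_le b : (0 < b)%N -> xi alpha b <= (3 * b%:R)^-1.
Proof.
move=> b0; have c3 := const_c_ge3 b; have b0' : 0 < b%:R :> R by rewrite ltr0n.
rewrite /xi lef_pV2 ?posrE ?mulr_gt0//; last by lra.
by rewrite mulrC ler_pM2l.
Qed.

(** This explains the entry [(1 - alpha_17^-1)^-1] in [c]: it makes the weight [1 - xi - tau_t] of
    [y_t] non-negative at [t = 17], hence afterwards. *)
Lemma xi_le_gap17 b : (0 < b)%N -> xi alpha b <= 1 - (s 17)^-1.
Proof.
move=> b0; have b0' : 0 < b%:R :> R by rewrite ltr0n.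
have c3 := const_c_ge3 b.
have h17 : 0 < 1 - (s 17)^-1.
  by rewrite subr_gt0 invf_lt1 ?alpha_seq_gt0// alpha_seq17_gt1.
rewrite /xi -[leRHS]invrK lef_pV2 ?posrE ?invr_gt0 ?mulr_gt0//; last by lra.
rewrite /const_c mulrDr mulr1.
set m := Num.max (6 / 5) _; set M := Num.max 2 _.
have h1 : (1 - (s 17)^-1)^-1 <= m by rewrite /m le_max lexx orbT.
have h2 : b%:R^-1 * m <= M by rewrite /M le_max lexx orbT.
have : b%:R * (b%:R^-1 * m) <= b%:R * M by rewrite ler_pM2l.
by rewrite mulVKf ?gt_eqF//; lra.
Qed.

Lemma weight_ge0 b t : (0 < b)%N -> 0 <= 1 - xi alpha b - tau_seq alpha t.
Proof.
move=> b0; rewrite /tau_seq; have [t16|t17] := leqP t 16.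
  rewrite alpha_seq_small//; have := xi_le b0.
  suff : (3 * b%:R)^-1 <= 3^-1 :> R by lra.
  by rewrite lef_pV2 ?posrE ?mulr_gt0 ?ltr0n// ler_peMr// ler1n.
have := xi_le_gap17 b0; suff : (s t)^-1 <= (s 17)^-1 by lra.
by rewrite lef_pV2 ?posrE ?alpha_seq_gt0// alpha_seq_le.
Qed.

Definition update_den (A0 : R) t : R :=
  A0 + s 0 ^+ 2 - s t ^+ 2 + \sum_(1 <= j < t.+1) s j.

Lemma update_den0 A0 : update_den A0 0 = A0.
Proof. by rewrite /update_den big_geq// addr0 addrK. Qed.

(** Together with [update_probM], this matches the weights of the Lyapunov function at consecutive
    steps. *)
Lemma update_denS A0 t :
  update_den A0 t.+1 + s t.+1 ^+ 2 - s t ^+ 2 - s t.+1 = update_den A0 t.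
Proof. by rewrite /update_den (big_nat_recr t.+1)//=; ring. Qed.

Lemma sum_alpha_seq_small t : (t <= 16)%N -> \sum_(1 <= j < t.+1) s j = 6 * t%:R.
Proof.
elim: t => [|t IH] ht; first by rewrite big_geq// mulr0.
rewrite big_nat_recr//= IH ?(ltnW ht)// alpha_seq_small// -natr1; ring.
Qed.

(* The increment of [t ^ (1 + alpha)] is at most twice [(t + 1) ^ alpha], a
   substitute for comparing the sum with an integral. *)
Lemma sum_alpha_seq_large t : (16 <= t)%N ->
  96 + a / 2 * (t%:R * t%:R `^ alpha - 16 * 16 `^ alpha) <=
  \sum_(1 <= j < t.+1) s j.
Proof.
have [a5 _ _ _ _] := coef_a_spec ha; have /andP[al0 al1] := ha.
elim: t => [//|t IH]; rewrite leq_eqVlt => /predU1P[<-|ht].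
  by rewrite sum_alpha_seq_small//; lra.
rewrite big_nat_recr//= (alpha_seq_large ht).
apply: (@le_trans _ _ (96 + a / 2 * (t%:R * t%:R `^ alpha - 16 * 16 `^ alpha)
    + a * t.+1%:R `^ alpha)); last by rewrite lerD2r IH.
have t0 : 0 < t%:R :> R by rewrite ltr0n; exact: leq_trans (ht : (16 <= t)%N).
have t1 : 1 <= t%:R :> R by rewrite ler1n -(ltr0n R).
have := powR_ratio_le al1 t0 (_ : t%:R <= t.+1%:R); rewrite ler_nat leqnSn.
move=> /(_ isT).
have := powR_ge0 t%:R alpha; have := powR_ge0 t.+1%:R alpha; rewrite -natr1.
move: (t%:R `^ alpha) (_ `^ alpha) (16 `^ alpha) t0 t1 => p q r; move: t%:R => x.
move=> x0 x1 q0 p0 h.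
(* With [p = x ^ alpha] and [q = (x + 1) ^ alpha], [x q <= (x + 1) p] gives
   [x (x - 1) q <= (x ^ 2 - 1) p]. *)
suff : (x + 1) * q - x * p <= 2 * q by nra.
suff : x * ((x - 1) * q) <= x * (x * p) by rewrite ler_pM2l//; lra.
have := ler_wpM2l (_ : 0 <= x - 1) h; rewrite subr_ge0 => /(_ x1); lra.
Qed.

(** For [t >= 17], [alpha_0 ^ 2 + 96 = 132] covers the loss [a / 2 * 16 * 16 ^ alpha <= 128] of the
    sum bound, and [alpha_t ^ 2] uses 3/8 of the coefficient 1/2. What remains is
    [a / 8 >= 1 / 40]. *)
Lemma update_den_ge A0 t : 0 <= A0 -> (0 < t)%N ->
  t%:R * t%:R `^ alpha / 40 <= update_den A0 t.
Proof.
move=> A00 t0; have [a5 a6 a16 _ atx] := coef_a_spec ha.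
have /andP[al0 al1] := ha.
have t1 : 1 <= t%:R :> R by rewrite ler1n.
rewrite /update_den (alpha_seq_small (leq0n _)); have [t16|t17] := leqP t 16.
  rewrite (alpha_seq_small t16) sum_alpha_seq_small//.
  have : t%:R `^ alpha <= t%:R by rewrite ler1_powR.
  have : t%:R <= 16 :> R by rewrite ler_nat.
  have := powR_ge0 t%:R alpha; nra.
rewrite alpha_seq_large//.
have := sum_alpha_seq_large (ltnW t17); have := atx t%:R.
rewrite ler_nat => /(_ (ltnW t17)).
move: (\sum_(1 <= j < t.+1) s j) (powR_ge0 t%:R alpha) a5 a16.
move: (t%:R `^ alpha) (16 `^ alpha) t1; move: t%:R (coef_a alpha) => x c p r.
move=> x1 S p0 c5 cr h1 h2.
have : (c * p) * (c * p) <= (c * p) * (3 / 8 * x).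
  by rewrite ler_wpM2l// mulr_ge0//; lra.
have : 1 / 5 * (x * p) <= c * (x * p).
  by rewrite ler_wpM2r// mulr_ge0//; lra.
lra.
Qed.

Lemma update_den_gt0 A0 t : 0 <= A0 -> (0 < t)%N -> 0 < update_den A0 t.
Proof.
move=> A00 t0; apply: lt_le_trans (update_den_ge A00 t0).
by rewrite divr_gt0// mulr_gt0 ?powR_gt0// ltr0n.
Qed.

Lemma update_probM A0 b t : 0 <= A0 -> (0 < t)%N ->
  update_den A0 t * update_prob alpha A0 b t =
  s t.-1 ^+ 2 - s t ^+ 2 + s t + xi alpha b * s t ^+ 2.
Proof.
move=> A00 t0; rewrite /update_prob -/(update_den A0 t) mulrC divfK//.
by rewrite gt_eqF// update_den_gt0.
Qed.

(** The constant is [480 = 40 * 12]: 40 from the denominator, and [12 = 36 / 3] from [a <= 6] and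
    [xi <= 1 / (3 b)]. *)
Lemma update_prob_le A0 b t : 0 <= A0 -> (0 < b)%N -> (0 < t)%N ->
    update_prob alpha A0 b t <= 1 ->
  update_prob alpha A0 b t <=
    480 * (1 / (b%:R * t%:R `^ (1 - alpha)) + 1 / t%:R).
Proof.
move=> A00 b0 t0 p1; have [a5 a6 _ _ _] := coef_a_spec ha.
have /andP[al0 al1] := ha.
have x0 : 0 < t%:R :> R by rewrite ltr0n.
have b0' : 0 < b%:R :> R by rewrite ltr0n.
have pa0 := powR_gt0 alpha x0; have pb0 := powR_gt0 (1 - alpha) x0.
(* At [t = 17] the difference of squares in the numerator can be positive. Up to there [p <= 1]
   suffices, as [480 / t >= 1]. *)
have [t17|t18] := leqP t 17.
  apply: (le_trans p1); apply: (@le_trans _ _ (480 * (1 / t%:R))).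
    by rewrite mulrA mulr1 ler_pdivlMr// mul1r ler_nat (leq_trans t17).
  by apply: ler_wpM2l; [exact: ler0n|rewrite lerDr divr_ge0// mulr_ge0// ltW].
have mono : s t.-1 <= s t by apply: alpha_seq_le; case: (t) t18.
have sq : s t.-1 ^+ 2 <= s t ^+ 2.
  by rewrite ler_sqr ?nnegrE //; exact/ltW/alpha_seq_gt0.
have den := update_den_ge A00 t0; have den0 := update_den_gt0 A00 t0.
rewrite -(ler_pM2l den0) update_probM//.
apply: (@le_trans _ _ (s t + xi alpha b * s t ^+ 2)); first lra.
have ppE : t%:R `^ alpha * t%:R `^ (1 - alpha) = t%:R.
  rewrite -powRD; last by rewrite (gt_eqF x0) implybT.
  by rewrite subrKC powRr1// ltW.
have nn : 0 <= 480 * (1 / (b%:R * t%:R `^ (1 - alpha)) + 1 / t%:R).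
  apply: mulr_ge0; first exact: ler0n.
  by rewrite addr_ge0 ?divr_ge0 ?mulr_ge0 ?powR_ge0.
apply: le_trans (ler_wpM2r nn den).
have -> : t%:R * t%:R `^ alpha / 40 *
    (480 * (1 / (b%:R * t%:R `^ (1 - alpha)) + 1 / t%:R)) =
    12 * t%:R `^ alpha + 12 * (t%:R `^ alpha ^+ 2 / b%:R).
  move: (t%:R `^ alpha) (t%:R `^ (1 - alpha)) pa0 pb0 ppE => p q p0 q0 <-.
  by field; rewrite !gt_eqF.
have xl := xi_le b0; rewrite alpha_seq_large ?(ltnW t18)//.
have h1 : a * t%:R `^ alpha <= 6 * t%:R `^ alpha by rewrite ler_pM2r.
have h2 : (a * t%:R `^ alpha) ^+ 2 <= 36 * t%:R `^ alpha ^+ 2.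
  by rewrite exprMn ler_pM2r ?exprn_gt0//; nra.
have h3 : xi alpha b * (a * t%:R `^ alpha) ^+ 2 <=
    (3 * b%:R)^-1 * (36 * t%:R `^ alpha ^+ 2).
  by apply: ler_pM => //; [exact/ltW/xi_gt0|exact: sqr_ge0].
have e : (3 * b%:R)^-1 * (36 * t%:R `^ alpha ^+ 2) = 12 * (t%:R `^ alpha ^+ 2 / b%:R).
  by field; rewrite gt_eqF.
lra.
Qed.

End Sequence.

End ParameterSequences.

(** * Histories of the random draws *)

Section FiniteRandomVariables.
Context {R : realType} {dsp : measure_display} {Omega : measurableType dsp}.
Variable P : probability Omega R.

Definition pmass {K : Type} (H : Omega -> K) (k : K) : R :=
  fine (P (H @^-1` [set k])).

Lemma pmass_ge0 {K : Type} (H : Omega -> K) k : 0 <= pmass H k.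
Proof. exact: fine_ge0. Qed.

(** The recursion is known outcome by outcome, so a history of non-zero mass has to be traded for an
    outcome that has it. *)
Lemma pmass_gt0_ex {K : Type} (H : Omega -> K) k : pmass H k != 0 ->
  exists o, H o = k.
Proof.
move=> h; apply/not_existsP => no; move/eqP: h; apply.
rewrite /pmass (_ : H @^-1` [set k] = set0) ?measure0//.
by apply/seteqP; split => // o /= /no.
Qed.

Lemma integral_pmass {K : finType} (H : Omega -> K) (phi : K -> R) :
    (forall k, measurable (H @^-1` [set k])) ->
  (\int[P]_o (phi (H o))%:E = (\sum_k pmass H k * phi k)%:E)%E.
Proof.
move=> mH.
have PE k : P (H @^-1` [set k]) = (pmass H k)%:E.
  by rewrite fineK// fin_num_measure.
under eq_integral => o _.
  have -> : (phi (H o))%:E =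
      (\sum_k (phi k)%:E * (\1_(H @^-1` [set k]) o)%:E)%E.
    rewrite (bigD1 (H o))//= big1 ?adde0.
      by rewrite indicE mem_set// mule1.
    move=> k kH; rewrite indicE memNset ?mule0// => /= e.
    by rewrite e eqxx in kH.
  over.
rewrite integral_sum//; last first.
  by move=> k; apply: integrableZl => //; exact: integrable_indic.
rewrite -sumEFin; apply: eq_bigr => k _.
rewrite integralZl//; last exact: integrable_indic.
rewrite integral_indic// setIT mulrC EFinM.
by congr (_ * _)%E; exact: PE.
Qed.

Lemma factor_through {K : Type} (H : Omega -> K) (X : Omega -> R) :
    (forall o o', H o = H o' -> X o = X o') ->
  exists phi : K -> R, forall o, X o = phi (H o).
Proof.
move=> h.
exists (fun k => if pselect (exists o, H o = k) is left e
                 then X (projT1 (cid e)) else 0) => o.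
case: pselect => [e|]; last by case; exists o.
by case: cid => o' /= e'; apply: h.
Qed.

End FiniteRandomVariables.

Section History.
Context {R : realType} {pb : problem R} (th : parameters R)
  {dsp : measure_display} {Omega : measurableType dsp}.
Variables (P : probability Omega R) (pr : process pb Omega).
Hypothesis smp : sampling th P pr.
Local Notation n := (pb_n pb).
Local Notation draw := ({set 'I_n} * bool)%type.

Definition round t (o : Omega) : draw := (pJ pr t o, pcoin pr t o).

Definition history t (o : Omega) : {ffun 'I_t -> draw} :=
  [ffun i => round (val i).+1 o].

(** Implications make the constraint total in [u] and void outside rounds 1 to [t], the shape in
    which [smp_indep] takes its events. *)
Let cylJ t (h : {ffun 'I_t -> draw}) u : set {set 'I_n} :=
  [set J | forall i : 'I_t, u = i.+1 -> J = (h i).1].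
Let cylc t (h : {ffun 'I_t -> draw}) u : set bool :=
  [set c | forall i : 'I_t, u = i.+1 -> c = (h i).2].

Lemma history_fiber t (h : {ffun 'I_t -> draw}) :
  history t @^-1` [set h] = \bigcap_(u in [set` iota 1 t])
    (pJ pr u @^-1` cylJ h u `&` pcoin pr u @^-1` cylc h u).
Proof.
apply/seteqP; split => [ o /= oh u _|o /= H].
  by rewrite -oh; split => i ui; rewrite ui ffunE.
apply/ffunP => i; rewrite ffunE /round.
have [|h1 h2] := H i.+1; first by rewrite /= mem_iota ltnS/= add1n ltnS.
by rewrite (h1 i erefl) (h2 i erefl) -surjective_pairing.
Qed.

Lemma measurable_pJ t (A : set {set 'I_n}) : (0 < t)%N ->
  measurable (pJ pr t @^-1` A).
Proof.
move=> t0; rewrite (_ : _ @^-1` _ = \bigcup_(S in A) (pJ pr t @^-1` [set S])).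
  apply: fin_bigcup_measurable; first exact: finite_finset.
  by move=> S _; exact: (smp_measJ smp).
by apply/seteqP; split => [ o Ao|o [S AS /= ->]//]; exists (pJ pr t o).
Qed.

Lemma measurable_pcoin t (A : set bool) : (0 < t)%N ->
  measurable (pcoin pr t @^-1` A).
Proof.
move=> t0; rewrite (_ : _ @^-1` _ = \bigcup_(c in A) (pcoin pr t @^-1` [set c])).
  apply: fin_bigcup_measurable; first exact: finite_finset.
  by move=> S _; exact: (smp_meascoin smp).
by apply/seteqP; split => [ o Ao|o [S AS /= ->]//]; exists (pcoin pr t o).
Qed.

Lemma measurable_history t (h : {ffun 'I_t -> draw}) :
  measurable (history t @^-1` [set h]).
Proof.
rewrite history_fiber; apply: fin_bigcap_measurable; first exact: finite_seq.
move=> u /=; rewrite mem_iota => /andP[u0 _].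
by apply: measurableI; [exact: measurable_pJ|exact: measurable_pcoin].
Qed.

Local Notation p t := (update_prob (par_alpha th) (par_atilde0 th) (par_b th) t).
Local Notation b := (par_b th).

(** Read off the law of the coin rather than computed from the parameters. *)
Lemma update_prob01 t : (0 < t)%N -> 0 <= p t <= 1.
Proof.
move=> t0; rewrite -!lee_fin -(smp_lawcoin smp t0) measure_ge0/=.
by apply: probability_le1; exact: measurable_pcoin.
Qed.

Lemma pcoin_false t : (0 < t)%N ->
  P (pcoin pr t @^-1` [set false]) = (1 - p t)%:E.
Proof.
move=> t0; rewrite (_ : _ @^-1` _ = ~` (pcoin pr t @^-1` [set true])).
  by rewrite probability_setC ?(smp_lawcoin smp)//; exact: measurable_pcoin.
by apply/seteqP; split => o /=; case: (pcoin pr t o).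
Qed.

Definition round_mass t (m : draw) : R :=
  (if #|m.1| == b then 'C(n, b)%:R^-1 else 0) * (if m.2 then p t else 1 - p t).

Lemma history_round_fiber t h m :
  (fun o => (history t o, round t.+1 o)) @^-1` [set (h, m)] =
  \bigcap_(u in [set` iota 1 t.+1])
    (pJ pr u @^-1` (cylJ h u `&` [set S | u = t.+1 -> S = m.1]) `&`
     pcoin pr u @^-1` (cylc h u `&` [set c | u = t.+1 -> c = m.2])).
Proof.
apply/seteqP; split => [ o [/= e1 e2] u uI|o H].
  have {uI} : u \in iota 1 t.+1 by [].
  rewrite mem_iota add1n => /andP[u0 ut2].
  have : (history t @^-1` [set h]) o by [].
  rewrite history_fiber => H.
  have [ut|ut] := ltnP u t.+1.
    have [|h1 h2] := H u; first by rewrite /= mem_iota add1n u0.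
    by split; split => // ut'; rewrite ut' ltnn in ut.
  have -> : u = t.+1 by apply/eqP; rewrite eqn_leq ut andbT.
  rewrite -e2 /=; split; split => // i /= [it];
    by have := ltn_ord i; rewrite -it ltnn.
have : (history t @^-1` [set h]) o.
  rewrite history_fiber => u uI; have {uI} : u \in iota 1 t by [].
  rewrite mem_iota add1n => /andP[u0 ut].
  have [|[h1 _] [h2 _]//] := H u.
  by change (u \in iota 1 t.+1); rewrite mem_iota u0 add1n ltnS ltnW.
move=> /= ->; have [|[_ h1] [_ h2]] := H t.+1.
  by change (t.+1 \in iota 1 t.+1); rewrite mem_iota add1n ltnSn.
by rewrite /round (h1 erefl) (h2 erefl) -surjective_pairing.
Qed.

Lemma history_round_mass t h m :
  P ((fun o => (history t o, round t.+1 o)) @^-1` [set (h, m)]) =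
  (pmass P (history t) h * round_mass t.+1 m)%:E.
Proof.
have iota_ok k : uniq (iota 1 k) /\ all (leq 1) (iota 1 k).
  by split; [exact: iota_uniq|apply/allP => u; rewrite mem_iota => /andP[]].
have [[u1 a1] [u2 a2]] := (iota_ok t, iota_ok t.+1).
rewrite history_round_fiber (smp_indep smp)//.
have iE : iota 1 t.+1 = iota 1 t ++ [:: t.+1] by rewrite -(addn1 t) iotaD add1n addn1.
rewrite iE big_cat big_seq1 EFinM.
congr (_ * _)%E.
  rewrite fineK ?fin_num_measure//; last exact: measurable_history.
  rewrite history_fiber (smp_indep smp)//.
  apply: eq_big_seq => u; rewrite mem_iota add1n => /andP[_ ut].
  congr (P _ * P _)%E; apply/seteqP; split => o /=; try by case.
    by split => // e; rewrite e ltnn in ut.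
  by split => // e; rewrite e ltnn in ut.
rewrite /round_mass EFinM; congr (_ * _)%E.
  rewrite -(smp_lawJ smp m.1 (ltn0Sn t)); congr (P _); apply/seteqP; split => o /=.
    by move=> [_]; apply.
  by move=> ->; split => // i [it]; have := ltn_ord i; rewrite -it ltnn.
rewrite (_ : _ @^-1` _ = pcoin pr t.+1 @^-1` [set m.2]).
  by case: m => S [] /=; rewrite ?(smp_lawcoin smp)// pcoin_false.
apply/seteqP; split => o /=.
  by move=> [_]; apply.
by move=> ->; split => // i [it]; have := ltn_ord i; rewrite -it ltnn.
Qed.

Lemma integral_history t (phi : {ffun 'I_t -> draw} -> R) :
  (\int[P]_o (phi (history t o))%:E =
   (\sum_h pmass P (history t) h * phi h)%:E)%E.
Proof. by apply: integral_pmass => h; exact: measurable_history. Qed.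

(** Tower property: the next round is independent of the history, so given the history the batch is
    uniform and the coin has parameter [p_(t+1)]. *)
Lemma integral_history_round t (phi : {ffun 'I_t -> draw} -> draw -> R) :
  (\int[P]_o (phi (history t o) (round t.+1 o))%:E =
   (\sum_h pmass P (history t) h * subset_avg b
     (fun S => p t.+1 * phi h (S, true) + (1 - p t.+1) * phi h (S, false)))%:E)%E.
Proof.
pose H o := (history t o, round t.+1 o).
have mH k : measurable (H @^-1` [set k]).
  case: k => h m; rewrite history_round_fiber.
  apply: fin_bigcap_measurable; first exact: finite_seq.
  move=> u uI; have {uI} : u \in iota 1 t.+1 by [].
  rewrite mem_iota => /andP[u0 _].
  by apply: measurableI; [exact: measurable_pJ|exact: measurable_pcoin].
rewrite (integral_pmass _ (fun k => phi k.1 k.2) mH); congr _%:E.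
rewrite (eq_bigr (fun k => pmass P H (k.1, k.2) * phi k.1 k.2)); last by case.
rewrite -(pair_bigA _ (fun h m => pmass P H (h, m) * phi h m))/=.
apply: eq_bigr => h _.
under eq_bigr do rewrite /pmass history_round_mass/= -mulrA.
rewrite -mulr_sumr; congr (_ * _).
rewrite (eq_bigr (fun k => round_mass t.+1 (k.1, k.2) * phi h (k.1, k.2))); last by case.
rewrite -(pair_bigA _ (fun S c => round_mass t.+1 (S, c) * phi h (S, c)))/=.
rewrite /subset_avg mulr_sumr [RHS]big_mkcond; apply: eq_bigr => S _ /=.
rewrite big_bool /round_mass /=; case: ifP => _; last by rewrite !mul0r addr0.
by rewrite -!mulrA -mulrDr.
Qed.

(** Some value of the coin has non-zero probability, so the history followed by [S] and that value
    has non-zero mass. Such an outcome supplies the proximal minimizer for the batch [S]. *)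
Lemma history_draw_ex t h (S : {set 'I_n}) : (0 < b <= n)%N ->
    pmass P (history t) h != 0 -> #|S| = b ->
  exists o, history t o = h /\ pJ pr t.+1 o = S.
Proof.
move=> /andP[_ bn] h0 Sb.
have C0 : 'C(n, b)%:R^-1 != 0 :> R by rewrite invr_eq0 pnatr_eq0 -lt0n bin_gt0.
have [c hc] : exists c : bool, (if c then p t.+1 else 1 - p t.+1) != 0.
  have [p0|p0] := eqVneq (p t.+1) 0; last by exists true.
  by exists false; rewrite p0 subr0 oner_neq0.
have [|o [e1 [e2 _]]] := @pmass_gt0_ex _ _ _ P _
    (fun o => (history t o, round t.+1 o)) (h, (S, c)).
  by rewrite /pmass history_round_mass/= !mulf_neq0// Sb eqxx.
by exists o.
Qed.

End History.

(** * The Lyapunov function *)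

Section Lyapunov.
Context {R : realType} {pb : problem R} {L : R} {th : parameters R}
  {w1 : 'rV[R]_(pb_dim pb)} {dsp : measure_display} {Omega : measurableType dsp}
  {P : probability Omega R} {pr : process pb Omega}.
Hypotheses (asm : assumptions pb L) (adm : admissible pb L th)
  (smp : sampling th P pr) (rcs : recursion th w1 pr)
  (lw1 : pb_l w1 \is a fin_num).
Local Notation n := (pb_n pb).
Local Notation l := (@pb_l R pb).
Local Notation xs := (pb_sol pb).
Local Notation al := (par_alpha th).
Local Notation b := (par_b th).
Local Notation A0 := (par_atilde0 th).
Local Notation eta := (par_eta th).
Local Notation s := (alpha_seq al).
Local Notation q := (xi al b).
Local Notation c := (const_c al b).
Local Notation tau := (tau_seq al).
Local Notation p t := (update_prob al A0 b t).

Lemma batch_gt0 : (0 < b)%N.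
Proof. by case/andP: (adm_b adm). Qed.

Lemma components_gt0 : (0 < n)%N.
Proof. by case/andP: (adm_b adm) => /leq_trans; apply. Qed.

Lemma xi_ge0 : 0 <= q.
Proof. exact/ltW/(xi_gt0 _ batch_gt0). Qed.

Lemma atilde0_ge0 : 0 <= A0.
Proof.
by apply: le_trans (adm_atilde0 adm); rewrite mulr_ge0 ?xi_ge0 ?sqr_ge0.
Qed.

Lemma const_c_gt0 : 0 < c.
Proof. by apply: lt_le_trans (const_c_ge3 al b); rewrite ltr0n. Qed.

Lemma step_size_le : (c + 1) * L * eta <= 1.
Proof.
have L0 := asm_L asm; have c3 := const_c_ge3 al b.
have cL : 0 < c * L + L by rewrite addr_gt0// mulr_gt0//; lra.
by have := adm_eta adm; rewrite ler_pdivlMr//; lra.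
Qed.

Lemma prox_coef_gt0 t : 0 < 1 / (2 * s t * eta).
Proof.
rewrite divr_gt0// !mulr_gt0 ?(adm_eta_gt0 adm)//.
exact: (alpha_seq_gt0 (adm_alpha adm)).
Qed.

Lemma pg_estimator t o : (0 < t)%N ->
  pg pr t.+1 o = estimator b (px pr t.+1 o) (pw pr t o) (pJ pr t o).
Proof. by move=> t0; rewrite (rec_g rcs). Qed.

Lemma iterates_fin t o :
  l (pw pr t.+1 o) \is a fin_num /\ l (py pr t.+1 o) \is a fin_num.
Proof.
elim: t => [|t [lw ly]]; first by have [-> _ -> _] := rec_init rcs o.
split; first by rewrite (rec_w rcs)//; case: ifP.
rewrite (rec_y rcs)//.
by have [] := sample_descent asm components_gt0 (alpha_seq_gt0 (adm_alpha adm) t.+1)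
  erefl xi_ge0 (weight_ge0 (adm_alpha adm) t.+1 batch_gt0) (adm_eta_gt0 adm)
  const_c_gt0 step_size_le
  (rec_x rcs o (ltn0Sn t)) lw ly (rec_z rcs o (ltn0Sn t)).
Qed.

Lemma history_succ t o o' : history pr t.+1 o = history pr t.+1 o' ->
  history pr t o = history pr t o' /\ round pr t.+1 o = round pr t.+1 o'.
Proof.
move=> /ffunP h; split.
  by apply/ffunP => i; have := h (widen_ord (leqnSn t) i); rewrite !ffunE.
by have := h ord_max; rewrite !ffunE.
Qed.

(** The coin of this round affects only the next checkpoint, which is therefore absent here. *)
Lemma draw_determines t o o' :
    pw pr t.+1 o = pw pr t.+1 o' -> py pr t.+1 o = py pr t.+1 o' ->
    pz pr t.+1 o = pz pr t.+1 o' -> pJ pr t.+1 o = pJ pr t.+1 o' ->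
  [/\ px pr t.+2 o = px pr t.+2 o', pz pr t.+2 o = pz pr t.+2 o'
    & py pr t.+2 o = py pr t.+2 o'].
Proof.
move=> ew ey ez eJ.
have ex : px pr t.+2 o = px pr t.+2 o' by rewrite !(rec_x rcs)// ew ey ez.
have eg : pg pr t.+2 o = pg pr t.+2 o' by rewrite !pg_estimator// ex ew eJ.
have ez' : pz pr t.+2 o = pz pr t.+2 o'.
  have m1 := rec_z rcs o (ltn0Sn t); have m2 := rec_z rcs o' (ltn0Sn t).
  rewrite -ez -eg in m2.
  exact: (prox_unique (asm_reg_gtNy asm) (asm_reg_convex asm)
    (prox_coef_gt0 t.+1) (asm_reg_proper asm) m1 m2).
by split => //; rewrite !(rec_y rcs)// ex ez' ez.
Qed.

Lemma history_determines t o o' : history pr t o = history pr t o' ->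
  [/\ pw pr t.+1 o = pw pr t.+1 o', py pr t.+1 o = py pr t.+1 o'
    & pz pr t.+1 o = pz pr t.+1 o'].
Proof.
elim: t => [_|t IH /history_succ[/IH[ew ey ez] [eJ ec]]].
  by have [-> _ -> ->] := rec_init rcs o; have [-> _ -> ->] := rec_init rcs o'.
have [_ -> ->] := draw_determines ew ey ez eJ.
by split => //; rewrite !(rec_w rcs _ (ltn0Sn t)) ec ew ey.
Qed.

(** The index is the number of completed rounds: the iterates at [t + 1] depend on the first [t]
    rounds. *)
Definition lyapunov t o : R :=
  s t ^+ 2 * gap (py pr t.+1 o) + update_den al A0 t * gap (pw pr t.+1 o)
  + sqnorm (pz pr t.+1 o - xs) / (2 * eta).

Lemma integral_history_factor t (X : Omega -> R) :
    (forall o o', history pr t o = history pr t o' -> X o = X o') ->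
  exists2 phi, forall o, X o = phi (history pr t o) &
    (\int[P]_o (X o)%:E = (\sum_h pmass P (history pr t) h * phi h)%:E)%E.
Proof.
move=> /factor_through[phi e]; exists phi => //.
by rewrite -(integral_history smp); apply: eq_integral => o _; rewrite e.
Qed.

Lemma lyapunov_step t :
  (\int[P]_o (lyapunov t.+1 o)%:E <= \int[P]_o (lyapunov t o)%:E)%E.
Proof.
have [psi psiE ->] : exists2 phi, forall o, lyapunov t o = phi (history pr t o) &
    (\int[P]_o (lyapunov t o)%:E =
     (\sum_h pmass P (history pr t) h * phi h)%:E)%E.
  apply: integral_history_factor => o o' /history_determines[ew ey ez].
  by rewrite /lyapunov ew ey ez.
(* These two terms depend on the batch but not on the coin. The checkpoint term depends on the coin
   but not on the batch, because the new checkpoint is one of the previous [y] and [w]. *)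
pose X1 o := s t.+1 ^+ 2 * gap (py pr t.+2 o)
  + sqnorm (pz pr t.+2 o - xs) / (2 * eta).
have [phi1 phi1E] : exists phi : _ -> R,
    forall o, X1 o = phi (history pr t o, pJ pr t.+1 o).
  apply: factor_through => o o' [/history_determines[ew ey ez] eJ].
  by rewrite /X1; have [_ -> ->] := draw_determines ew ey ez eJ.
have [gy gyE] : exists phi : _ -> R,
    forall o, gap (py pr t.+1 o) = phi (history pr t o).
  by apply: factor_through => o o' /history_determines[_ ->].
have [gw gwE] : exists phi : _ -> R,
    forall o, gap (pw pr t.+1 o) = phi (history pr t o).
  by apply: factor_through => o o' /history_determines[->].
pose phi h (m : {set 'I_n} * bool) := phi1 (h, m.1)
  + update_den al A0 t.+1 * (if m.2 then gy h else gw h).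
have -> : (\int[P]_o (lyapunov t.+1 o)%:E =
    \int[P]_o (phi (history pr t o) (round pr t.+1 o))%:E)%E.
  apply: eq_integral => o _; congr _%:E.
  rewrite /phi /= -phi1E -gyE -gwE /lyapunov /X1 (rec_w rcs)//.
  by case: (pcoin _ _ _); ring.
rewrite (integral_history_round smp) lee_fin; apply: ler_sum => h _.
have [->|h0] := eqVneq (pmass P (history pr t) h) 0; first by rewrite !mul0r.
rewrite ler_wpM2l ?pmass_ge0//.
(* [o0] represents the history [h]: what is known after [t] rounds is evaluated there. *)
have [ o0 o0h] := pmass_gt0_ex h0; rewrite -o0h -psiE.
have hb := adm_b adm.
have ex (S : {set 'I_n}) : #|S| = b ->
    exists o, history pr t o = history pr t o0 /\ pJ pr t.+1 o = S.
  by rewrite o0h; exact: (history_draw_ex smp hb h0).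
(* The minimizer for batch [S], read off an outcome that draws it. By [ex], the default 0 is not
   reached when [#|S| = b]. *)
pose zJ (S : {set 'I_n}) := if pselect (exists o, history pr t o = history pr t o0 /\
  pJ pr t.+1 o = S) is left e then pz pr t.+2 (projT1 (cid e)) else 0.
pose x := px pr t.+2 o0; pose z := pz pr t.+1 o0.
have zJE S o : history pr t o = history pr t o0 -> pJ pr t.+1 o = S ->
    [/\ px pr t.+2 o = x, pz pr t.+2 o = zJ S
      & py pr t.+2 o = x + tau t.+1 *: (zJ S - z)].
  move=> oh oS; have [ew ey ez] := history_determines oh.
  have ex2 : px pr t.+2 o = x by rewrite /x !(rec_x rcs)// ew ey ez.
  have ez2 : pz pr t.+2 o = zJ S.
    rewrite /zJ; case: pselect => [e|]; last by case; exists o.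
    case: cid => o' /= [ oh' oS'].
    have [ew' ey' ez'] := history_determines oh'.
    by have [] := @draw_determines t o o';
      rewrite ?ew ?ew' ?ey ?ey' ?ez ?ez' ?oS ?oS'.
  by split=> //; rewrite (rec_y rcs)// ex2 ez2 ez.
have desc : subset_avg b (fun S => phi1 (history pr t o0, S)) <=
    q * s t.+1 ^+ 2 * gap (pw pr t.+1 o0)
    + (s t.+1 ^+ 2 - q * s t.+1 ^+ 2 - s t.+1) * gap (py pr t.+1 o0)
    + sqnorm (z - xs) / (2 * eta).
  have [lw ly] := iterates_fin t o0.
  apply: le_trans (expected_descent asm components_gt0
    (alpha_seq_gt0 (adm_alpha adm) t.+1) erefl xi_ge0
    (weight_ge0 (adm_alpha adm) t.+1 batch_gt0) (adm_eta_gt0 adm)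
    const_c_gt0 step_size_le
    (rec_x rcs o0 (ltn0Sn t)) lw ly hb erefl (zJ := zJ) _).
    apply: le_subset_avg => S Sb; have [ o [ oh oS]] := ex S Sb.
    by have [_ ez ey] := zJE S o oh oS; rewrite -oh -{1}oS -phi1E /X1 ez ey.
  move=> S Sb; have [ o [ oh oS]] := ex S Sb.
  have [ex' ez _] := zJE S o oh oS; have [ew ey ez0] := history_determines oh.
  have := rec_z rcs o (ltn0Sn t).
  by rewrite (pg_estimator _ (ltn0Sn t)) ez ez0 ew oS ex'; apply.
rewrite [leLHS](_ : _ = subset_avg b (fun S => phi1 (history pr t o0, S)) +
    update_den al A0 t.+1 * (p t.+1 * gap (py pr t.+1 o0)
      + (1 - p t.+1) * gap (pw pr t.+1 o0))); last first.
  rewrite -[X in _ = _ + X](subset_avg_cst hb) -subset_avgD.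
  by apply: eq_subset_avg => S _; rewrite /phi /= gyE gwE; ring.
apply: le_trans (lerD desc (lexx _)) _.
(* Collecting coefficients: [gap y] ends with [alpha_t ^ 2] and [gap w] with the denominator of
   index [t]. *)
have num := update_probM (adm_alpha adm) b atilde0_ge0 (ltn0Sn t).
have den := update_denS al A0 t.
have e u v D : D * (p t.+1 * u + (1 - p t.+1) * v) =
    D * p t.+1 * u + (D - D * p t.+1) * v by ring.
rewrite /lyapunov -/z -den e num /=.
by rewrite le_eqVlt; apply/orP; left; apply/eqP; ring.
Qed.

Lemma lyapunov_le t : (\int[P]_o (lyapunov t o)%:E <=
  ((36 + A0) * gap w1 + sqnorm (w1 - xs) / (2 * eta))%:E)%E.
Proof.
elim: t => [|t IH]; last exact: le_trans (lyapunov_step t) IH.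
under eq_integral => o _.
  rewrite /lyapunov; have [-> _ -> ->] := rec_init rcs o.
  over.
rewrite integral_cst//= probability_setT mule1 lee_fin.
by rewrite update_den0 (alpha_seq_small _ (leq0n _)); lra.
Qed.

Lemma expected_gapE t : expected_gap P pr t.+1 =
  (\int[P]_o (gap (pw pr t.+1 o))%:E)%E.
Proof.
apply: eq_integral => o _; rewrite (objective_gap asm)//.
by have [] := iterates_fin t o.
Qed.

Lemma expected_gap_le t : (0 < t)%N -> (expected_gap P pr t.+1 <=
  (((36 + A0) * gap w1 + sqnorm (w1 - xs) / (2 * eta)) / update_den al A0 t)%:E)%E.
Proof.
move=> t0; rewrite expected_gapE; have := lyapunov_le t.
have [psi psiE ->] : exists2 phi, forall o, lyapunov t o = phi (history pr t o) &
    (\int[P]_o (lyapunov t o)%:E =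
     (\sum_h pmass P (history pr t) h * phi h)%:E)%E.
  apply: integral_history_factor => o o' /history_determines[ew ey ez].
  by rewrite /lyapunov ew ey ez.
have [gw gwE ->] : exists2 phi, forall o, gap (pw pr t.+1 o) = phi (history pr t o) &
    (\int[P]_o (gap (pw pr t.+1 o))%:E =
     (\sum_h pmass P (history pr t) h * phi h)%:E)%E.
  by apply: integral_history_factor => o o' /history_determines[->].
rewrite !lee_fin; have d0 := update_den_gt0 (adm_alpha adm) atilde0_ge0 t0.
rewrite ler_pdivlMr//; apply: le_trans; rewrite mulr_suml.
apply: ler_sum => h _.
have [->|h0] := eqVneq (pmass P (history pr t) h) 0; first by rewrite !mul0r.
rewrite -mulrA ler_wpM2l ?pmass_ge0//.
have [ o <-] := pmass_gt0_ex h0; rewrite -psiE -gwE /lyapunov mulrC.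
have [_ ly] := iterates_fin t o.
have h1 : 0 <= s t ^+ 2 * gap (py pr t.+1 o).
  by rewrite mulr_ge0 ?sqr_ge0// (gap_ge0 asm ly).
have h2 : 0 <= sqnorm (pz pr t.+1 o - xs) / (2 * eta).
  by rewrite divr_ge0 ?sqnorm_ge0// mulr_ge0// ltW// (adm_eta_gt0 adm).
lra.
Qed.

End Lyapunov.

(** * Sums and powers *)

Section RealAnalysis.
Context {R : realType}.
Implicit Types (a x y : R) (n t T : nat).

Lemma le_lnB1 x : 0 < x -> ln x <= x - 1.
Proof.
move=> x0; have := @le_ln1Dx R (x - 1); rewrite subrKC; apply; lra.
Qed.

(** The increments of [ln] dominate, by [ln u <= u - 1] at [u = (T + 1) / (T + 2)]. *)
Lemma harmonic_le T : (0 < T)%N -> \sum_(1 <= t < T.+1) t%:R^-1 <= 1 + ln T%:R :> R.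
Proof.
elim: T => // -[_ _|T IH _].
  by rewrite big_nat1 ln1 invr1 addr0.
rewrite big_nat_recr//=; apply: (le_trans (lerD (IH isT) (lexx _))).
rewrite -addrA lerD2l -lerBrDl.
have h1 : 0 < T.+1%:R :> R by rewrite ltr0n.
have h2 : 0 < T.+2%:R :> R by rewrite ltr0n.
rewrite -lerN2 opprB -ln_div ?posrE//; apply: (le_trans (le_lnB1 _)).
  by rewrite divr_gt0.
have -> : T.+1%:R = T.+2%:R - 1 :> R by rewrite -[in RHS]natr1 addrK.
move: (T.+2%:R : R) h2 => x x0.
have : x / x = 1 by rewrite divff// gt_eqF.
lra.
Qed.

(** Terms with [t > n] are below 1. This gives [ln n] in place of [ln T]; the excess [T] is later
    absorbed by the mini-batch cost. *)
Lemma harmonic_capped_le n T : (0 < n)%N ->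
  \sum_(1 <= t < T.+1) n%:R / t%:R <= n%:R * (1 + ln n%:R) + T%:R :> R.
Proof.
move=> n0; have n0' : 0 < n%:R :> R by rewrite ltr0n.
have lnn : 0 <= ln n%:R :> R by rewrite ln_ge0// ler1n.
elim: T => [|T IH]; first by rewrite big_geq// addr0 mulr_ge0// addr_ge0.
have [Tn|nT] := leqP T.+1 n.
  rewrite -mulr_sumr; apply: (@le_trans _ _ (n%:R * (1 + ln n%:R))); last by rewrite lerDl.
  rewrite ler_pM2l//; apply: (le_trans (harmonic_le _)) => //.
  by rewrite lerD2l ler_ln ?posrE ?ltr0n// ler_nat.
rewrite big_nat_recr//=; apply: (le_trans (lerD IH (lexx _))).
rewrite -addrA lerD2l -[leRHS]natr1 lerD2l ler_pdivrMr ?ltr0n// mul1r ler_nat.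
exact: ltnW.
Qed.

(** Weighted AM-GM for [x] and 1: with [r] the right-hand side, add [ln u <= u - 1] at [x / r] and
    [1 / r] with weights [a] and [1 - a]. *)
Lemma powR_bernoulli a x : 0 <= a <= 1 -> 0 < x -> x `^ a <= 1 + a * (x - 1).
Proof.
move=> /andP[a0 a1] x0; set r := 1 + _.
have r0 : 0 < r by rewrite /r; nra.
rewrite -[leRHS]powRr1 ?(ltW r0)// /powR (gt_eqF x0) (gt_eqF r0) /= mul1r ler_expR.
have h1 := le_lnB1 (divr_gt0 x0 r0).
have h2 : ln r^-1 <= r^-1 - 1 by apply: le_lnB1; rewrite invr_gt0.
rewrite ln_div ?posrE// in h1; rewrite lnV ?posrE// in h2.
have h3 := ler_wpM2l a0 h1; have h4 : (1 - a) * - ln r <= (1 - a) * (r^-1 - 1).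
  by rewrite ler_wpM2l// subr_ge0.
have e : a * (x / r - 1) + (1 - a) * (r^-1 - 1) = 0.
  have -> : a * (x / r - 1) + (1 - a) * (r^-1 - 1) = r / r - 1 by rewrite {3}/r; ring.
  by rewrite divff ?subrr// gt_eqF.
lra.
Qed.

Lemma powR_sum_le a T : 0 < a <= 1 ->
  \sum_(1 <= t < T.+1) t%:R `^ a / t%:R <= T%:R `^ a / a.
Proof.
move=> /andP[a0 a1]; elim: T => [|T IH].
  by rewrite big_geq// divr_ge0 ?powR_ge0// ltW.
rewrite big_nat_recr//=; apply: (le_trans (lerD IH (lexx _))).
rewrite -lerBrDl -mulrBl ler_pdivlMr//.
have x0 : 0 < T.+1%:R :> R by rewrite ltr0n.
(* Bernoulli is applied to the ratio of consecutive integers, which would be 0 for the first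
   term. *)
case: T x0 {IH} => [|T] x0.
  by rewrite powR0 ?gt_eqF// powR1 subr0 invr1 !mul1r.
have y0 : 0 < T.+1%:R :> R by rewrite ltr0n.
have a01 : 0 <= a <= 1 by rewrite ltW.
have := powR_bernoulli a01 (divr_gt0 y0 x0).
have xa := powR_gt0 a x0.
have -> : T.+1%:R `^ a = (T.+1%:R / T.+2%:R) `^ a * T.+2%:R `^ a.
  by rewrite -powRM ?divr_ge0// ?divfK// gt_eqF.
have -> : T.+1%:R = T.+2%:R - 1 :> R by rewrite -[in RHS]natr1 addrK.
move: (T.+2%:R : R) x0 xa => x x0 xa h.
have {}h := ler_wpM2r (ltW xa) h.
have e : (x - 1) / x - 1 = - x^-1 by field; rewrite gt_eqF.
rewrite e in h *; rewrite -mulrA [x^-1 * a]mulrC; lra.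
Qed.

Section Horizon.
Variables (K a eps : R).
Hypotheses (K1 : 1 <= K) (a01 : 0 < a <= 1) (eps01 : 0 < eps < 1).
Let X := (eps `^ (1 / (a + 1)))^-1.

Let a1_gt0 : 0 < a + 1.
Proof. by case/andP: a01 => a0 _; lra. Qed.

Let X_ge1 : 1 <= X.
Proof.
case/andP: eps01 => e0 e1; rewrite /X -powRN -[leLHS](powRr0 eps).
by apply: ger_powR; rewrite ?e0 ?(ltW e1)// oppr_le0 divr_ge0// ltW.
Qed.

Let X_powR r : X `^ r = (eps `^ (r / (a + 1)))^-1.
Proof. by rewrite /X -!powRN -powRrM mulNr mul1r [_^-1 * r]mulrC. Qed.

(** Take the first integer above [K * X]. As [K >= 1], [(K X) ^ (a + 1) >= K / eps]; as [K X >= 1],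
    rounding costs at most a factor 2. *)
Lemma horizon_ex : exists T : nat,
  [/\ (0 < T)%N, K * (1 / T%:R `^ (a + 1)) <= eps & T%:R <= 2 * K * X].
Proof.
case/andP: eps01 => e0 e1; have KX1 : 1 <= K * X.
  by rewrite -[leLHS]mulr1 ler_pM.
have KX0 : 0 <= K * X by apply: le_trans KX1.
have /andP[T1 T2] := truncn_itv KX0.
exists (Num.truncn (K * X)).+1; split => //; last by rewrite -natr1; lra.
rewrite mul1r ler_pdivrMr ?powR_gt0 ?ltr0n//.
apply: (@le_trans _ _ (eps * (K * X) `^ (a + 1))); last first.
  rewrite ler_pM2l//; apply: ge0_ler_powR; rewrite ?nnegrE//; first exact: ltW.
  exact: ltW T2.
rewrite powRM ?(le_trans _ K1)//; last exact: le_trans X_ge1.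
rewrite X_powR divff ?gt_eqF// powRr1 ?(ltW e0)// mulrCA divff ?gt_eqF// mulr1.
by apply: le1r_powR => //; case/andP: a01 => a0 _; lra.
Qed.

Lemma horizon_powR T : T%:R <= 2 * K * X ->
  T%:R `^ a <= 2 * K * (1 / eps `^ (a / (a + 1))).
Proof.
case/andP: a01 => a0 al1; case/andP: eps01 => e0 e1 hT.
have K2 : 1 <= 2 * K by have := K1; lra.
apply: (@le_trans _ _ ((2 * K * X) `^ a)).
  by apply: ge0_ler_powR; rewrite ?nnegrE ?(le_trans _ hT)// ltW.
rewrite powRM ?(le_trans _ K2)//; last exact: le_trans X_ge1.
rewrite X_powR mul1r.
by rewrite ler_wpM2r ?invr_ge0 ?powR_ge0// ler1_powR.
Qed.

Lemma horizon_le T : T%:R <= 2 * K * X -> T%:R <= 2 * K * (1 / eps).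
Proof.
case/andP: a01 => a0 al1; case/andP: eps01 => e0 e1 hT.
apply: (le_trans hT); rewrite ler_pM2l; last by have := K1; lra.
rewrite mul1r lef_pV2 ?posrE ?powR_gt0//.
rewrite -[leLHS]powRr1 ?(ltW e0)//; apply: ger_powR; first by rewrite e0 ltW.
by rewrite ler_pdivrMr//; lra.
Qed.

End Horizon.

Lemma powR_compl_inv a t : (0 < t)%N -> (t%:R `^ (1 - a))^-1 = t%:R `^ a / t%:R.
Proof.
move=> t0; have x0 : 0 < t%:R :> R by rewrite ltr0n.
rewrite powRB; last by rewrite (gt_eqF x0) implybT.
by rewrite powRr1 ?ltW// invf_div.
Qed.

(** The meaning of the quotients in [alpha_hat]: below one of them, the corresponding power is at
    most 2. *)
Lemma powR_le2 a y : 0 <= a -> 0 < y -> 0 < ln y -> a <= ln 2 / ln y -> y `^ a <= 2.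
Proof.
move=> a0 y0 ly0; rewrite ler_pdivlMr// => h.
by rewrite /powR (gt_eqF y0) -[leRHS]lnK ?posrE// ler_expR.
Qed.

(** For [t <= n], [t ^ a <= n ^ a <= 2]; beyond, [n * t ^ (a - 1) <= n ^ a <= 2]. *)
Lemma sum_powR_capped a n T : 0 < a <= 1 -> (0 < n)%N -> n%:R `^ a <= 2 ->
  \sum_(1 <= t < T.+1) n%:R * (t%:R `^ a / t%:R) <=
  2 * \sum_(1 <= t < T.+1) n%:R / t%:R + 2 * T%:R.
Proof.
move=> /andP[a0 a1] n0 na.
have -> : 2 * T%:R = \sum_(1 <= t < T.+1) 2 :> R.
  by rewrite sumr_const_nat subn1 mulr_natr.
rewrite mulr_sumr -big_split/=; apply: ler_sum_nat => t /andP[t0 _].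
have x0 : 0 < t%:R :> R by rewrite ltr0n.
have y0 : 0 < n%:R :> R by rewrite ltr0n.
have [tn|/ltnW nt] := leqP t n.
  have : t%:R `^ a <= 2.
    by apply: le_trans na; apply: ge0_ler_powR; rewrite ?nnegrE ?ler_nat// ltW.
  move=> h; rewrite -[leLHS]addr0 lerD// mulrCA ler_wpM2r// divr_ge0// ltW.
have := powR_ratio_le a1 y0 (_ : n%:R <= t%:R); rewrite ler_nat => /(_ nt) h.
apply: (@le_trans _ _ 2); last by rewrite lerDr mulr_ge0// divr_ge0.
rewrite mulrA ler_pdivrMr//; apply: (le_trans h).
by rewrite mulrC ler_pM2r.
Qed.

End RealAnalysis.

(** * Arithmetic of the complexity bound *)

Section ComplexityBound.
Context {R : realType}.
Variables (K eps0 : R).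
Hypotheses (K1 : 1 <= K) (eps001 : 0 < eps0 < 1).
Implicit Types (a eps : R) (n b t T : nat).

Let delta := ln (1 / eps0).
(** A lower bound of the logarithmic factor, uniform in [n >= 2] and [eps <= eps0]. *)
Let mu := Num.min (ln 2) delta.
Let lg n eps : R := Num.min (ln n%:R) (ln (1 / eps)).

Let ln2_gt0 : 0 < ln (2 : R).
Proof. by rewrite ln_gt0//; lra. Qed.

Let delta_gt0 : 0 < delta.
Proof.
by case/andP: eps001 => e0 e1; rewrite /delta ln_gt0// ltr_pdivlMr// mul1r.
Qed.

Let mu_gt0 : 0 < mu.
Proof. by rewrite lt_min ln2_gt0 delta_gt0. Qed.

Let ln_inv_ge eps : 0 < eps <= eps0 -> delta <= ln (1 / eps).
Proof.
move=> /andP[e0 ee]; case/andP: eps001 => e00 _.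
rewrite ler_ln ?posrE ?divr_gt0// !mul1r lef_pV2 ?posrE//.
Qed.

Let ln_nat_ge n : (1 < n)%N -> ln 2 <= ln n%:R :> R.
Proof.
move=> n1; rewrite ler_ln ?posrE//; last by rewrite ltr0n (ltn_trans _ n1).
by rewrite ler_nat.
Qed.

Let lg_ge_mu n eps : (1 < n)%N -> 0 < eps <= eps0 -> mu <= lg n eps.
Proof.
move=> n1 he; rewrite /lg /mu le_min !ge_min ln_nat_ge// ln_inv_ge//.
by rewrite orbT.
Qed.

Let c1 := mu^-1 + (ln (2 * K) / delta + 1).

Let M_ge1 : 1 <= 2 * K. Proof. by have := K1; lra. Qed.

Let c1_ge0 : 0 <= c1.
Proof.
have m := ltW mu_gt0; have d := ltW delta_gt0; have lM := ln_ge0 M_ge1.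
by rewrite /c1 !addr_ge0 ?invr_ge0 ?divr_ge0.
Qed.

Lemma harmonic_log n T eps : (1 < n)%N -> (0 < T)%N -> 0 < eps <= eps0 ->
    T%:R <= 2 * K * (1 / eps) ->
  \sum_(1 <= t < T.+1) n%:R / t%:R <= c1 * (n%:R * lg n eps) + T%:R.
Proof.
move=> n1 T0 he hT; have n0 : (0 < n)%N by exact: ltn_trans n1.
have n0' : 0 < n%:R :> R by rewrite ltr0n.
have lgm := lg_ge_mu n1 he; have dl := ln_inv_ge he.
have M1 := M_ge1; have lM : 0 <= ln (2 * K) by rewrite ln_ge0.
have e0 : 0 < 1 / eps by case/andP: he => e0 _; rewrite divr_gt0.
have one : 1 <= mu^-1 * lg n eps by rewrite ler_pdivlMl ?mulr1 ?mu_gt0.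
have key x : \sum_(1 <= t < T.+1) n%:R / t%:R <= n%:R * (1 + x) + T%:R ->
    x <= (ln (2 * K) / delta + 1) * lg n eps ->
    \sum_(1 <= t < T.+1) n%:R / t%:R <= c1 * (n%:R * lg n eps) + T%:R.
  move=> /le_trans h1 h2; apply: h1; rewrite lerD2r mulrCA ler_pM2l//.
  by rewrite /c1 mulrDl lerD.
have cK0 : 0 <= ln (2 * K) / delta by rewrite divr_ge0// ltW.
have [nE|En] := leP (ln n%:R) (ln (1 / eps)).
  have lgE : lg n eps = ln n%:R by rewrite /lg min_l.
  apply: (key (ln n%:R)); first exact: harmonic_capped_le.
  have : 0 <= ln n%:R :> R by rewrite ln_ge0// ler1n.
  by rewrite lgE; nra.
have lgE : lg n eps = ln (1 / eps) by rewrite /lg min_r// ltW.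
apply: (key (ln T%:R)).
  rewrite -mulr_sumr (@le_trans _ _ (n%:R * (1 + ln T%:R)))//; last by rewrite lerDl.
  by rewrite ler_pM2l// harmonic_le.
apply: (@le_trans _ _ (ln (2 * K) + ln (1 / eps))).
  rewrite -lnM ?posrE//; last exact: lt_le_trans M1.
  rewrite ler_ln ?posrE ?ltr0n// mulr_gt0//; exact: lt_le_trans M1.
have h : ln (2 * K) <= ln (2 * K) / delta * ln (1 / eps).
  by rewrite mulrAC ler_pdivlMr ?delta_gt0// ler_wpM2l.
by rewrite lgE; lra.
Qed.

Let c2 := 10 / mu + (ln 2)^-1 + delta^-1.

Let c2_ge0 : 0 <= c2.
Proof.
have m := ltW mu_gt0; have d := ltW delta_gt0; have l2 := ltW ln2_gt0.
by rewrite /c2 !addr_ge0 ?divr_ge0 ?invr_ge0.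
Qed.

Let ln_ceil eps : 0 < eps <= eps0 ->
  ln 2 <= ln ((Num.ceil (1 / eps))%:~R : R) <= ln 2 + ln (1 / eps).
Proof.
move=> /andP[e0 ee]; case/andP: eps001 => _ e1.
have E1 : 1 < 1 / eps by rewrite ltr_pdivlMr// mul1r (le_lt_trans ee).
have /andP[h1 h2] := ceil_itv (1 / eps).
have c1' : 1 < (Num.ceil (1 / eps))%:~R :> R by apply: lt_le_trans h2.
have c2' : 2 <= (Num.ceil (1 / eps))%:~R :> R.
  have : (1 < Num.ceil (1 / eps))%R by rewrite -(ltr_int R).
  by rewrite -lezD1 -(ler_int R) intrD.
have E0 : 0 < 1 / eps by lra.
rewrite intrD in h1.
rewrite -lnM ?posrE// !ler_ln ?posrE//; lra.
Qed.

(** If [a > alpha_hat], then [1 / a] is below both [ln n / ln 2] and [ln (ceil (1 / eps)) / ln 2];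
    if [a > 1 / 10], it is below 10. This absorbs the [1 / a] of [powR_sum_le]. *)
Lemma inv_alpha_le a n eps : 0 < a -> (1 < n)%N -> 0 < eps <= eps0 ->
  Num.min (alpha_hat n eps) (1 / 10) < a -> 1 / a <= c2 * lg n eps.
Proof.
move=> a0 n1 he; have lgm := lg_ge_mu n1 he; have mu0 := mu_gt0.
have l2 := ln2_gt0; have d0 := delta_gt0; have de := ln_inv_ge he.
have lg0 : 0 < lg n eps by apply: lt_le_trans lgm.
rewrite gt_min => /orP[|a10]; last first.
  apply: (@le_trans _ _ (10 / mu * lg n eps)).
    rewrite mulrAC ler_pdivlMr// mul1r ler_pdivrMl//; nra.
  rewrite ler_pM2r// /c2 -addrA lerDl addr_ge0 ?invr_ge0// ltW//.
have lc : 0 < ln ((Num.ceil (1 / eps))%:~R : R).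
  by have /andP[+ _] := ln_ceil he; apply: lt_le_trans.
have ln0' : 0 < ln n%:R :> R by apply: lt_le_trans (ln_nat_ge n1).
rewrite /alpha_hat gt_max => /andP[h1 h2].
rewrite ltr_pdivrMr// in h1; rewrite ltr_pdivrMr// in h2.
have m0 : 0 <= 10 / mu by rewrite divr_ge0// ltW.
have i2 : 0 < (ln 2)^-1 :> R by rewrite invr_gt0.
have id : 0 < delta^-1 by rewrite invr_gt0.
have [_ hc] := andP (ln_ceil he).
suff : 1 / a <= ((ln 2)^-1 + delta^-1) * lg n eps.
  by move=> /le_trans; apply; rewrite ler_pM2r// /c2 -addrA lerDr.
rewrite ler_pdivrMr//.
have k2 : (ln 2)^-1 * ln 2 = 1 :> R by rewrite mulVf// gt_eqF.
have kd : delta^-1 * delta = 1 by rewrite mulVf// gt_eqF.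
have [nE|En] := leP (ln n%:R) (ln (1 / eps)).
  rewrite /lg min_l//.
  have : (ln 2)^-1 * ln 2 <= (ln 2)^-1 * (a * ln n%:R) by rewrite ler_pM2l// ltW.
  rewrite k2.
  have : 0 <= delta^-1 * (a * ln n%:R) by rewrite !mulr_ge0// ltW.
  lra.
rewrite /lg min_r ?(ltW En)//.
have : 1 <= (ln 2)^-1 * (a * (ln 2 + ln (1 / eps))).
  rewrite -[leLHS]k2 ler_pM2l//; apply: (le_trans (ltW h1)); rewrite ler_pM2l//.
have e : (ln 2)^-1 * (a * (ln 2 + ln (1 / eps))) =
    a * ((ln 2)^-1 * ln 2) + (ln 2)^-1 * a * ln (1 / eps) by ring.
have : a * 1 <= a * (delta^-1 * ln (1 / eps)).
  by rewrite ler_pM2l// -[leLHS]kd ler_pM2l.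
rewrite e k2; lra.
Qed.

(** As [alpha_hat] is a maximum, either [(1 / eps) ^ a <= 2], which bounds [t ^ a] up to the
    horizon, or [n ^ a <= 2] and [sum_powR_capped] applies. *)
Lemma small_alpha_sum a n T eps : 0 < a <= 1 -> (1 < n)%N -> (0 < T)%N ->
    0 < eps <= eps0 -> T%:R <= 2 * K * (1 / eps) ->
    a <= Num.min (alpha_hat n eps) (1 / 10) ->
  \sum_(1 <= t < T.+1) n%:R * (t%:R `^ a / t%:R) <=
  2 * (2 * K) * (\sum_(1 <= t < T.+1) n%:R / t%:R) + 2 * T%:R.
Proof.
move=> /andP[a0 a1] n1 T0 he hT; have n0 : (0 < n)%N by exact: ltn_trans n1.
have M1 := M_ge1; have /andP[e0 _] := he.
have E0 : 0 < 1 / eps by rewrite divr_gt0.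
have S0 : 0 <= \sum_(1 <= t < T.+1) n%:R / t%:R :> R.
  by apply: sumr_ge0 => t _; rewrite divr_ge0.
rewrite le_min => /andP[+ _]; rewrite /alpha_hat le_max => /orP[h|h].
  have /andP[lc _] := ln_ceil he.
  have c0 : 0 < ln ((Num.ceil (1 / eps))%:~R : R) by apply: lt_le_trans lc.
  have Ec : 1 / eps <= (Num.ceil (1 / eps))%:~R by exact: ceil_ge.
  have Ea : (1 / eps) `^ a <= 2.
    apply: (le_trans _ (powR_le2 (ltW a0) (lt_le_trans E0 Ec) c0 h)).
    by apply: ge0_ler_powR; rewrite ?nnegrE ?(le_trans _ Ec)// ltW.
  have Ta t : (0 < t <= T)%N -> t%:R `^ a <= 2 * (2 * K).
    move=> /andP[t0 tT].
    apply: (@le_trans _ _ ((2 * K * (1 / eps)) `^ a)).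
      have tM : t%:R <= 2 * K * (1 / eps) by apply: le_trans hT; rewrite ler_nat.
      by apply: ge0_ler_powR; rewrite ?nnegrE ?(ltW a0)//; exact: le_trans tM.
    rewrite powRM ?(ltW E0)//; last by have := M1; lra.
    rewrite [leRHS]mulrC ler_pM ?powR_ge0//.
    by rewrite ler1_powR.
  apply: (@le_trans _ _ (2 * (2 * K) * (\sum_(1 <= t < T.+1) n%:R / t%:R)));
    last by rewrite lerDl mulr_ge0.
  rewrite mulr_sumr; apply: ler_sum_nat => t ht.
  by rewrite mulrCA ler_wpM2r ?divr_ge0// Ta.
have na : n%:R `^ a <= 2.
  apply: powR_le2 h => //; [exact: ltW|by rewrite ltr0n|].
  exact: lt_le_trans ln2_gt0 (ln_nat_ge n1).
have a01 : 0 < a <= 1 by rewrite a0.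
apply: (le_trans (sum_powR_capped T a01 n0 na)); rewrite lerD2r.
by rewrite ler_wpM2r//; have := M1; lra.
Qed.

(** The probabilistic input is reduced to two bounds on a sequence [p], and the horizon is fixed
    before [p]. *)
Lemma complexity_arith : exists2 C : R, 0 < C &
  forall a n b eps, 0 < a <= 1 -> (1 <= b <= n)%N -> 0 < eps <= eps0 ->
  exists T, [/\ (0 < T)%N, K * (1 / T%:R `^ (a + 1)) <= eps &
    forall p : nat -> R,
      (forall t, (0 < t)%N -> p t <= 1) ->
      (forall t, (0 < t)%N ->
        p t <= 480 * (1 / (b%:R * t%:R `^ (1 - a)) + 1 / t%:R)) ->
      n%:R + \sum_(1 <= t < T) (2 * b%:R + n%:R * p t) <=
      C * complexity_bound a n b eps].
Proof.
have M1 := M_ge1; have mu0 := mu_gt0; have c10 := c1_ge0; have c20 := c2_ge0.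
set M := 2 * K in M1.
(* The summands pay for the initial full gradient, the mini-batches, and the two parts of the
   checkpoint cost: [n / (b t ^ (1 - a))] and [n / t]. *)
pose C := mu^-1 + 2 * M
  + 480 * (2 * M * (c1 + M) + 2 * M + M * c2 + (c1 + M)).
have i0 : 0 < mu^-1 by rewrite invr_gt0.
have q1 : 0 <= M * c2 by rewrite mulr_ge0//; lra.
have q2 : 0 <= 2 * M * (c1 + M) by rewrite mulr_ge0//; lra.
exists C; first by rewrite /C; lra.
move=> a n b eps a01 /andP[b1 bn] he.
have n0 : (0 < n)%N by exact: leq_trans bn.
have b1' : 1 <= b%:R :> R by rewrite ler1n.
have eps01 : 0 < eps < 1.
  by case/andP: he => -> /= /le_lt_trans; apply; case/andP: eps001.
have [T [T0 hT TX]] := horizon_ex K1 a01 eps01.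
exists T; split => // p p1 pb.
pose X := (eps `^ (1 / (a + 1)))^-1; rewrite -/M -/X in TX.
set Z := complexity_bound a n b eps.
have [e0 e1] := andP eps01.
have X0 : 0 < X by rewrite invr_gt0 powR_gt0.
have T0' : 0 <= T%:R :> R by [].
have bT : b%:R * T%:R <= M * (b%:R * X).
  by rewrite mulrCA ler_wpM2l.
have TbT : T%:R <= b%:R * T%:R :> R by rewrite ler_peMl.
(* For [n = 1] the logarithmic factor is 0 and absorbs nothing; but then [b = 1] and each iteration
   costs at most 3 calls. *)
have [n1|n1] := leqP n 1.
  have nE : n = 1%N by apply/eqP; rewrite eqn_leq n1.
  have bE : b = 1%N by apply/eqP; rewrite eqn_leq -{1}nE bn.
  have ZE : Z = b%:R * X.
    have l0 : 0 <= ln (1 / eps) by rewrite ln_ge0// ler_pdivlMr// mul1r ltW.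
    by rewrite /Z /complexity_bound nE ln1 /= (min_l l0) !mulr0 !addr0 if_same.
  apply: (@le_trans _ _ (4 * (b%:R * T%:R))).
    apply: (@le_trans _ _ (1 + \sum_(1 <= t < T) 3)).
      rewrite nE lerD2l; apply: ler_sum_nat => t /andP[t0 _].
      by have := p1 t t0; rewrite bE; lra.
    rewrite sumr_const_nat bE mul1r -(mulr_natr 3) natrB//.
    have : 1 <= T%:R :> R by rewrite ler1n.
    lra.
  rewrite ZE; apply: (@le_trans _ _ (4 * (M * (b%:R * X)))); first lra.
  rewrite mulrA ler_wpM2r//; first by rewrite mulr_ge0// ltW.
  by rewrite /C; lra.
have lgm := lg_ge_mu n1 he; have lg0 : 0 < lg n eps by apply: lt_le_trans lgm.
have n0' : 0 < n%:R :> R by rewrite ltr0n.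
have Z1 : b%:R * X + n%:R * lg n eps <= Z.
  rewrite /Z /complexity_bound /= -/(lg n eps) -/X; case: ifP => _ //.
  rewrite lerD2l mulrDl lerDr !mulr_ge0 ?divr_ge0 ?invr_ge0 ?powR_ge0//.
  exact: ltW.
have bX0 : 0 <= b%:R * X by rewrite mulr_ge0// ltW.
have nlg0 : 0 <= n%:R * lg n eps by rewrite mulr_ge0// ltW.
have nZ : n%:R <= mu^-1 * Z.
  rewrite ler_pdivlMl//; apply: (@le_trans _ _ (n%:R * lg n eps)); last lra.
  by rewrite mulrC ler_pM2l.
have bTZ : b%:R * T%:R <= M * Z.
  by apply: (le_trans bT); rewrite ler_wpM2l//; lra.
have TE : T%:R <= 2 * K * (1 / eps) by exact: (horizon_le K1 a01 eps01 TX).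
pose SA : R := \sum_(1 <= t < T.+1) n%:R / t%:R.
pose SB : R := \sum_(1 <= t < T.+1) n%:R * (t%:R `^ a / t%:R).
have SAZ : SA <= (c1 + M) * Z.
  apply: (le_trans (harmonic_log n1 T0 he TE)).
  have h : c1 * (n%:R * lg n eps) <= c1 * Z by rewrite ler_wpM2l//; lra.
  by move: h; rewrite -/(lg n eps); lra.
have SA0 : 0 <= SA by apply: sumr_ge0 => t _; rewrite divr_ge0.
have SB0 : 0 <= SB.
  by apply: sumr_ge0 => t _; rewrite mulr_ge0// divr_ge0// powR_ge0.
have Z0 : 0 <= Z by lra.
have b0 : 0 < b%:R :> R by lra.
have SBZ : SB / b%:R <= (2 * M * (c1 + M) + 2 * M + M * c2) * Z.
  have [sm|lg_] := leP a (Num.min (alpha_hat n eps) (1 / 10)).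
    apply: (@le_trans _ _ SB); first by rewrite ler_pdivrMr// ler_peMr.
    apply: (le_trans (small_alpha_sum a01 n1 T0 he TE sm)).
    have : 2 * M * SA <= 2 * M * ((c1 + M) * Z) by rewrite ler_wpM2l//; lra.
    have : 0 <= M * c2 * Z by rewrite mulr_ge0.
    rewrite -/M -/SA; lra.
  pose Y := 1 / eps `^ (a / (a + 1)).
  have Y0 : 0 <= Y by rewrite divr_ge0 ?powR_ge0.
  have ZY : n%:R / b%:R * Y * lg n eps <= Z.
    rewrite /Z /complexity_bound (lt_geF lg_) /= -/(lg n eps) -/X -/Y mulrDl; lra.
  have a0 : 0 < a by case/andP: a01.
  have SBY : SB <= n%:R * (M * Y) * (c2 * lg n eps).
    rewrite /SB -mulr_sumr -mulrA ler_pM2l//.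
    apply: (le_trans (powR_sum_le T a01)).
    apply: ler_pM; rewrite ?powR_ge0 ?invr_ge0 ?(ltW a0)//.
      exact: (horizon_powR K1 a01 eps01 TX).
    by rewrite -div1r; exact: inv_alpha_le.
  apply: (@le_trans _ _ (M * c2 * (n%:R / b%:R * Y * lg n eps))).
    rewrite ler_pdivrMr//; apply: (le_trans SBY).
    by rewrite le_eqVlt; apply/orP; left; apply/eqP; field; rewrite gt_eqF.
  apply: (@le_trans _ _ (M * c2 * Z)); first by rewrite ler_wpM2l.
  rewrite ler_wpM2r//; lra.
have sumE : \sum_(1 <= t < T.+1) (2 * b%:R
      + (480 * b%:R^-1 * (n%:R * (t%:R `^ a / t%:R)) + 480 * (n%:R / t%:R))) =
    2 * (b%:R * T%:R) + 480 * (SB / b%:R + SA).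
  rewrite big_split big_split/= /SA /SB sumr_const_nat subn1/= -!mulr_sumr.
  by rewrite -(mulr_natr (2 * b%:R)); ring.
apply: (@le_trans _ _ (n%:R + (2 * (b%:R * T%:R) + 480 * (SB / b%:R + SA)))).
  rewrite lerD2l -sumE big_nat_recr//= -[leLHS]addr0; apply: lerD.
    apply: ler_sum_nat => t /andP[t0 _]; rewrite lerD2l.
    apply: (le_trans (ler_wpM2l (ltW n0') (pb t t0))).
    rewrite mul1r invfM powR_compl_inv// mul1r.
    by rewrite le_eqVlt; apply/orP; left; apply/eqP; ring.
  by rewrite !addr_ge0 ?mulr_ge0 ?divr_ge0 ?invr_ge0 ?powR_ge0 ?ler0n.
rewrite /C; lra.
Qed.

End ComplexityBound.

(** * Oracle complexity *)

Section OracleCalls.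
Context {R : realType} {pb : problem R} (th : parameters R)
  {dsp : measure_display} {Omega : measurableType dsp}
  {P : probability Omega R} {pr : process pb Omega}.
Hypothesis smp : sampling th P pr.
Local Notation n := (pb_n pb).
Local Notation b := (par_b th).
Local Notation p t := (update_prob (par_alpha th) (par_atilde0 th) b t).

Let calls t o : \bar R := (ifo_calls th pr t o)%:E.

Let callsE t o : calls t o =
  ((2 * b%:R)%:E + n%:R%:E * (\1_(pcoin pr t @^-1` [set true]) o)%:E)%E.
Proof.
rewrite /calls /ifo_calls indicE -EFinM -EFinD natrD !natrM; congr (_ + _ * _)%:E.
case: (boolP (pcoin pr t o)) => h; first by rewrite mem_set.
by rewrite memNset//= => h'; rewrite h' in h.
Qed.

Let integrable_coin t : (0 < t)%N -> P.-integrable setT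
  (fun o => n%:R%:E * (\1_(pcoin pr t @^-1` [set true]) o)%:E)%E.
Proof.
move=> t0; apply: integrableZl => //; apply: integrable_indic.
exact: (measurable_pcoin smp).
Qed.

Let integrable_cst (r : R) : P.-integrable setT (fun=> r%:E).
Proof. exact: finite_measure_integrable_cst. Qed.

Let integrable_calls t : (0 < t)%N -> P.-integrable setT (calls t).
Proof.
move=> t0; rewrite (funext (callsE t)).
by apply: integrableD => //; exact: integrable_coin.
Qed.

Let integral_cstP (r : R) : (\int[P]_o (r%:E : \bar R))%E = r%:E.
Proof. by rewrite integral_cst//= probability_setT mule1. Qed.

Lemma expected_ifo_calls t : (0 < t)%N ->
  ('E_P[ifo_calls th pr t])%E = (2 * b%:R + n%:R * p t)%:E.
Proof.
move=> t0; rewrite unlock -/(calls t).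
under eq_integral do rewrite -/(calls t _) callsE.
rewrite integralD//; last exact: integrable_coin.
have mc := measurable_pcoin smp [set true] t0.
rewrite integral_cstP (integralZl measurableT (integrable_indic _ mc))//.
rewrite integral_indic// setIT.
rewrite EFinD; congr (_ + _)%E; rewrite EFinM; congr (_ * _)%E.
exact: (smp_lawcoin smp t0).
Qed.

Lemma expected_ifo_total T : ('E_P[ifo_total th pr T])%E =
  (n%:R + \sum_(1 <= t < T) (2 * b%:R + n%:R * p t))%:E.
Proof.
rewrite unlock.
under eq_integral => o _.
  rewrite /ifo_total big_add1 EFinD -sumEFin.
  under eq_bigr => t _ do rewrite -/(calls t.+1 o).
  over.
rewrite integralD//=; last first.
  by apply: integrable_sum => // t _; exact: integrable_calls.
rewrite integral_cstP integral_sum//; last by move=> t; exact: integrable_calls.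
rewrite big_add1 EFinD -sumEFin; congr (_ + _)%E.
by apply: eq_bigr => t _; rewrite -expected_ifo_calls// unlock.
Qed.

End OracleCalls.

(** * Convergence rate with explicit constant *)

Section Rate.
Context {R : realType}.

(** Here [160 = 40 * 4]: 40 from [update_den_ge], 4 from passing from [t + 1] to [t + 2]. The
    separate [|Delta|] serves [T = 1], and the final 1 gives the bound [1 <= K] required by the
    horizon. Absolute values allow arbitrary real bounds. *)
Definition rate_const (Delta rho eta0 A0 : R) : R :=
  160 * ((36 + `|A0|) * `|Delta| + `|rho| / (2 * eta0)) + `|Delta| + 1.

Lemma rate_const_ge1 Delta rho eta0 A0 : 0 < eta0 ->
  1 <= rate_const Delta rho eta0 A0.
Proof.
move=> e0; rewrite /rate_const lerDr addr_ge0//.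
have h2 : 0 <= `|rho| / (2 * eta0) by rewrite divr_ge0// mulr_ge0// ltW.
by rewrite mulr_ge0// addr_ge0// mulr_ge0// addr_ge0.
Qed.

Context {pb : problem R} {L : R} {th : parameters R} {w1 : 'rV[R]_(pb_dim pb)}
  {dsp : measure_display} {Omega : measurableType dsp}
  {P : probability Omega R} {pr : process pb Omega}.
Hypotheses (asm : assumptions pb L) (adm : admissible pb L th)
  (smp : sampling th P pr) (rcs : recursion th w1 pr).
Variables (Delta rho eta0 A0 : R).
Hypotheses (eta00 : 0 < eta0) (eta_ge : eta0 <= par_eta th)
  (A0_ge : par_atilde0 th <= A0)
  (Delta_ge : (objective pb w1 - objective pb (pb_sol pb) <= Delta%:E)%E)
  (rho_ge : sqnorm (w1 - pb_sol pb) <= rho).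

Lemma initial_fin : pb_l w1 \is a fin_num.
Proof.
have /fineK fs := sol_fin asm; move: Delta_ge.
rewrite /objective -fs; have := asm_reg_gtNy asm w1.
by case: (pb_l w1).
Qed.

Lemma expected_gap_rate T : (0 < T)%N -> (expected_gap P pr T <=
  (rate_const Delta rho eta0 A0 * (1 / T%:R `^ (par_alpha th + 1)))%:E)%E.
Proof.
have lw1 := initial_fin; have g0 := gap_ge0 asm lw1.
have gD : gap w1 <= `|Delta|.
  move: Delta_ge; rewrite (objective_gap asm lw1) lee_fin => /le_trans; apply.
  exact: ler_norm.
have /andP[al0 al1] := adm_alpha adm; have at0 := atilde0_ge0 adm.
have e0 := eta00; have ege := eta_ge.
set V := (36 + `|A0|) * `|Delta| + `|rho| / (2 * eta0).
have V0 : 0 <= V.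
  have h2 : 0 <= `|rho| / (2 * eta0) by rewrite divr_ge0// mulr_ge0// ltW.
  by rewrite addr_ge0// mulr_ge0// addr_ge0.
have D0 := normr_ge0 Delta.
(* For [T = 1] the checkpoint is the initial point. Otherwise [T = t + 2], and the Lyapunov bound is
   used after [t + 1] rounds. *)
case: T => [//|[_|t _]].
  rewrite (expected_gapE asm adm rcs lw1).
  under eq_integral => o _ do (have [-> _ _ _] := rec_init rcs o).
  rewrite integral_cst//= probability_setT mule1 lee_fin powR1 divr1 mulr1.
  rewrite /rate_const -/V; lra.
apply: (le_trans (expected_gap_le asm adm smp rcs lw1 (ltn0Sn t))).
rewrite lee_fin; set W := _ + sqnorm _ / _.
have WV : W <= V.
  apply: lerD; first by rewrite ler_pM// ?addr_ge0// lerD2l (le_trans A0_ge) ?ler_norm.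
  apply: ler_pM; rewrite ?sqnorm_ge0 ?invr_ge0 ?mulr_ge0//; first lra.
    by rewrite (le_trans rho_ge) ?ler_norm.
  by rewrite lef_pV2 ?posrE; lra.
have x0 : 0 < t.+1%:R :> R by rewrite ltr0n.
have := update_den_ge (adm_alpha adm) at0 (ltn0Sn t).
have := update_den_gt0 (adm_alpha adm) at0 (ltn0Sn t).
move: (update_den _ _ _) => D Dg0 Dge.
have y0 : 0 < t.+2%:R `^ (par_alpha th + 1) :> R by rewrite powR_gt0// ltr0n.
have pE : t.+1%:R `^ (par_alpha th + 1) = t.+1%:R * t.+1%:R `^ par_alpha th :> R.
  rewrite powRD; last by rewrite (gt_eqF x0) implybT.
  by rewrite powRr1 ?(ltW x0)// mulrC.
have yx : t.+2%:R `^ (par_alpha th + 1) <= 4 * t.+1%:R `^ (par_alpha th + 1) :> R.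
  apply: (@le_trans _ _ ((2 * t.+1%:R) `^ (par_alpha th + 1))).
    apply: ge0_ler_powR; rewrite ?nnegrE ?mulr_ge0//; first lra.
    by rewrite -natrM ler_nat mul2n -addnn addSn ltnS leq_addl.
  rewrite powRM// ler_wpM2r ?powR_ge0//.
  have -> : 4 = 2 `^ 2%:R :> R by rewrite powR_mulrn//; lra.
  by apply: ler_powR; lra.
rewrite pE in yx; rewrite ler_pdivrMr// -mulrA.
have r160 : 1 / 160 <= 1 / t.+2%:R `^ (par_alpha th + 1) * D.
  rewrite [leRHS](_ : _ = D / t.+2%:R `^ (par_alpha th + 1)).
    by rewrite ler_pdivlMr//; lra.
  by rewrite mul1r mulrC.
move: (1 / _ `^ _ * D) r160 => r r160.
have : V * (1 / 160) <= V * r by rewrite ler_wpM2l.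
have : 0 <= (`|Delta| + 1) * r by rewrite mulr_ge0//; lra.
rewrite /rate_const -/V; lra.
Qed.

End Rate.

Theorem theorem2 (R : realType) :
  (* (i) *)
  (forall alpha L Delta rho eta0 A0 : R, 0 <= alpha <= 1 -> 0 < eta0 ->
    exists2 C : R, 0 < C &
    forall (pb : problem R) (th : parameters R) (w1 : 'rV[R]_(pb_dim pb))
      (dsp : measure_display) (Omega : measurableType dsp)
      (P : probability Omega R) (pr : process pb Omega),
    assumptions pb L -> admissible pb L th -> par_alpha th = alpha ->
    eta0 <= par_eta th -> par_atilde0 th <= A0 ->
    (objective pb w1 - objective pb (pb_sol pb) <= Delta%:E)%E ->
    sqnorm (w1 - pb_sol pb) <= rho ->
    sampling th P pr -> recursion th w1 pr ->
    forall T : nat, (0 < T)%N ->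
      (expected_gap P pr T <= (C * (1 / T%:R `^ (alpha + 1)))%:E)%E)
  /\
  (* (ii) *)
  (forall alpha : R, 0 <= alpha <= 1 ->
    exists2 C : R, 0 < C &
    forall (L : R) (pb : problem R) (th : parameters R)
      (w1 : 'rV[R]_(pb_dim pb))
      (dsp : measure_display) (Omega : measurableType dsp)
      (P : probability Omega R) (pr : process pb Omega),
    assumptions pb L -> admissible pb L th -> par_alpha th = alpha ->
    sampling th P pr -> recursion th w1 pr ->
    forall t : nat, (17 <= t)%N ->
      ('E_P[ifo_calls th pr t] <=
        (C * ((par_b th)%:R
              + (pb_n pb)%:R / ((par_b th)%:R * t%:R `^ (1 - alpha))
              + (pb_n pb)%:R / t%:R))%:E)%E)
  /\
  (* (iii) *)
  (forall L Delta rho eta0 A0 eps0 : R, 0 < eta0 -> 0 < eps0 < 1 ->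
    exists2 C : R, 0 < C &
    forall (pb : problem R) (th : parameters R) (w1 : 'rV[R]_(pb_dim pb))
      (dsp : measure_display) (Omega : measurableType dsp)
      (P : probability Omega R) (pr : process pb Omega),
    assumptions pb L -> admissible pb L th -> 0 < par_alpha th ->
    eta0 <= par_eta th -> par_atilde0 th <= A0 ->
    (objective pb w1 - objective pb (pb_sol pb) <= Delta%:E)%E ->
    sqnorm (w1 - pb_sol pb) <= rho ->
    sampling th P pr -> recursion th w1 pr ->
    forall eps : R, 0 < eps <= eps0 ->
      (expected_complexity th P pr eps <=
        (C * complexity_bound (par_alpha th) (pb_n pb) (par_b th) eps)%:E)%E).
Proof.
split; [|split].
- move=> alpha L Delta rho eta0 A0 _ e0.
  exists (rate_const Delta rho eta0 A0).
    exact: lt_le_trans ltr01 (rate_const_ge1 _ _ _ e0).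
  move=> pb th w1 dsp Omega P pr asm adm <- ege Age Dge rge smp rcs T T0.
  exact: (expected_gap_rate asm adm smp rcs e0 ege Age Dge rge).
(* [482 = 480 + 2]: the update probability plus the [2 b] mini-batch calls. *)
- move=> alpha _; exists 482; first by rewrite ltr0n.
  move=> L pb th w1 dsp Omega P pr asm adm al smp rcs t t17.
  have t0 : (0 < t)%N by exact: leq_trans t17.
  have b0 := batch_gt0 adm; have A00 := atilde0_ge0 adm.
  have /andP[_ p1] := update_prob01 smp t0.
  rewrite (expected_ifo_calls smp t0) lee_fin -al.
  have h := update_prob_le (adm_alpha adm) A00 b0 t0 p1.
  have {}h := ler_wpM2l (ler0n R (pb_n pb)) h.
  have h1 : 0 <= (pb_n pb)%:R / ((par_b th)%:R * t%:R `^ (1 - par_alpha th)).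
    by rewrite divr_ge0// mulr_ge0 ?powR_ge0.
  have h2 : 0 <= (pb_n pb)%:R / t%:R :> R by rewrite divr_ge0.
  have h3 : 0 <= (par_b th)%:R :> R by [].
  lra.
- move=> L Delta rho eta0 A0 eps0 e0 eps01.
  (* [rate_const] does not involve [alpha], so a single [C] serves all exponents. *)
  have K1 := rate_const_ge1 Delta rho A0 e0.
  have [C C0 hC] := complexity_arith K1 eps01.
  exists C => // pb th w1 dsp Omega P pr asm adm al0 ege Age Dge rge smp rcs eps he.
  have /andP[_ al1] := adm_alpha adm.
  have al01 : 0 < par_alpha th <= 1 by rewrite al0.
  have [T [T0 hT cost]] := hC _ _ _ _ al01 (adm_b adm) he.
  have gapT : (expected_gap P pr T <= eps%:E)%E.
    apply: (le_trans (expected_gap_rate asm adm smp rcs e0 ege Age Dge rge T0)).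
    by rewrite lee_fin.
  apply: (@le_trans _ _ ('E_P[ifo_total th pr T])%E).
    by apply: ereal_inf_lbound; exists T.
  rewrite (expected_ifo_total smp) lee_fin; apply: cost => t t0.
    by have /andP[] := update_prob01 smp t0.
  have /andP[_ p1] := update_prob01 smp t0.
  exact: (update_prob_le (adm_alpha adm) (atilde0_ge0 adm) (batch_gt0 adm) t0 p1).
Qed.
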